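(* Let $n_1,\dots,n_m\ge1$ and $d_1,\dots,d_m\ge 1$ be integers, and let $X$ denote the image of the Segre–Veronese embedding $$\mathbb{P}^{n_1}\times\mathbb{P}^{n_2}\times\cdots\times\mathbb{P}^{n_m}\hookrightarrow\mathbb{P}^{\prod_{i=1}^m\binom{n_i+d_i}{d_i}-1}$$ of multidegree $(d_1,d_2,\dots,d_m)$. (a) If $m\ge3$ and $d_i=1$ for at least three values of $1\le i\le m$, then $X$ fails property $\mathbf{N}_4$. (b) If $m\ge 3$ and $d_i=1$ for exactly two values of $1\le i\le m$, then $X$ fails property $\mathbf{N}_{q}$ with $q=2\min_{\{i\,\mid\, d_i>1\}}d_i+2$. (c) If $m\ge3$ and $d_i=1$ for at most one value of $1\le i\le m$, or if $m\ge 2$ and $d_i>1$ for all $1\le i\le m$, then $X$ fails property $\mathbf{N}_{q}$ with $q=2\min_{\{i\ne j\,\mid\, d_i,d_j>1\}}(d_i+d_j)-2$.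
   Context: $k$ is an algebraically closed field. The Segre–Veronese embedding of multidegree $(d_1,\dots,d_m)$ is the embedding by the complete linear system $|\mathcal{O}(d_1,\dots,d_m)|$ on $\mathbb{P}^{n_1}\times\cdots\times\mathbb{P}^{n_m}$. For $p\ge1$, a nondegenerate closed subscheme $X\subset\mathbb{P}^N=\operatorname{Proj}S$, $S=k[x_0,\dots,x_N]$, with saturated homogeneous ideal $I_X$, satisfies $\mathbf{N}_{2,p}$ if $\operatorname{Tor}_i^S(I_X,k)$ is concentrated in degrees $\le i+2$ for all $0\le i\le p-1$ (i.e. $I_X$ is generated by quadrics and its minimal free resolution is linear for the first $p$ steps). $X$ satisfies property $\mathbf{N}_p$ (of Green and Lazarsfeld) if it is projectively normal (property $\mathbf{N}_0$) and satisfies $\mathbf{N}_{2,p}$. *)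

(* Defs.v *)
(* Mathematical Components with multinomials. *)
From mathcomp Require Import all_boot all_order all_algebra.
From mathcomp Require Export mpoly.

Set Implicit Arguments.
Unset Strict Implicit.
Unset Printing Implicit Defensive.

Import GRing.Theory.
Local Open Scope ring_scope.

(* S = k[x_0, ..., x_{N-1}] is the homogeneous coordinate ring of P^{N-1};
   ideals of S are predicates on S. *)

Section Resolutions.
Variables (k : fieldType) (N : nat).
Local Notation S := {mpoly k[N]}.

(* A graded resolution of the homogeneous ideal I,
     ... -> F_2 -> F_1 -> F_0 -> I -> 0,
   by free modules F_i = \bigoplus_a S(- deg i a) of finite rank rk i.  Elements
   of F_i are row vectors, so that maps act by right multiplication. *)
Record graded_free_resolution (I : S -> Prop) := GradedFreeResolution {
  rk : nat -> nat;
  deg : forall i, 'I_(rk i) -> nat;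
  aug : 'cV[S]_(rk 0);
  diff : forall i, 'M[S]_(rk i.+1, rk i);
  aug_homog : forall a, aug a 0 \is (deg a).-homog;
  diff_homog : forall i (a : 'I_(rk i.+1)) (b : 'I_(rk i)),
    if (deg b <= deg a)%N then diff i a b \is (deg a - deg b).-homog
    else diff i a b == 0;
  aug_onto : forall f, I f <-> exists u : 'rV[S]_(rk 0), f = (u *m aug) 0 0;
  exact0 : forall u : 'rV[S]_(rk 0),
    u *m aug = 0 <-> exists w : 'rV[S]_(rk 1), u = w *m diff 0;
  exactS : forall i (u : 'rV[S]_(rk i.+1)),
    u *m diff i = 0 <-> exists w : 'rV[S]_(rk i.+2), u = w *m diff i.+1 }.

Variables (I : S -> Prop) (F : graded_free_resolution I).

(* The differential of F \otimes_S k, where k = S / (x_0, ..., x_{N-1}). *)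
Definition diff_k i : 'M[k]_(rk F i.+1, rk F i) :=
  map_mx (fun f : S => f@_0%MM) (diff F i).

Definition is_cycle i : 'rV[k]_(rk F i) -> Prop :=
  match i with
  | 0 => fun=> True
  | i'.+1 => fun v => v *m diff_k i' = 0
  end.

Definition is_boundary i (v : 'rV[k]_(rk F i)) : Prop :=
  exists w : 'rV[k]_(rk F i.+1), v = w *m diff_k i.

Definition in_degree j i (v : 'rV[k]_(rk F i)) : Prop :=
  forall a, v 0 a != 0 -> deg a = j.

(* The degree j part of Tor_i^S(I, k) = H_i(F \otimes_S k) vanishes. *)
Definition Tor_vanishes i j : Prop :=
  forall v : 'rV[k]_(rk F i), in_degree j v -> is_cycle v -> is_boundary v.

End Resolutions.

Section PropertyN.
Variables (k : fieldType) (N : nat).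
Local Notation S := {mpoly k[N]}.

(* Tor does not depend on the resolution, and a resolution exists by Hilbert's
   basis theorem; hence "for some F" and "for every F" mean the same here. *)
Definition property_N2 (p : nat) (I : S -> Prop) : Prop :=
  exists F : graded_free_resolution I,
    forall i j, (i < p)%N -> (i + 2 < j)%N -> Tor_vanishes F i j.

(* S / I is an integrally closed domain.  The condition on P says that
   a / b is a root of the monic polynomial P over S / I, after clearing
   denominators. *)
Definition prime_ideal (I : S -> Prop) : Prop :=
  ~ I 1 /\ forall f g, I (f * g) -> I f \/ I g.

Definition quotient_integrally_closed (I : S -> Prop) : Prop :=
  forall a b : S, ~ I b ->
    (exists2 P : {poly S}, P \is monic &
       I (\sum_(i < size P) P`_i * a ^+ i * b ^+ ((size P).-1 - i))) ->
    exists c : S, I (a - c * b).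

(* Subsets of P^{N-1} are given by all the homogeneous coordinate vectors of
   their points. *)
Definition homogeneous_ideal (X : ('I_N -> k) -> Prop) (f : S) : Prop :=
  forall v, X v -> f.@[v] = 0.

Definition projectively_normal (X : ('I_N -> k) -> Prop) : Prop :=
  prime_ideal (homogeneous_ideal X) /\
  quotient_integrally_closed (homogeneous_ideal X).

Definition property_N (p : nat) (X : ('I_N -> k) -> Prop) : Prop :=
  projectively_normal X /\ property_N2 p (homogeneous_ideal X).

End PropertyN.

Section SegreVeronese.
Variables (k : fieldType) (m : nat) (n d : 'I_m -> nat).

(* The exponents of the monomials of multidegree (d_1, ..., d_m) in m groups of
   n_i + 1 variables; these monomials are a basis of H^0(O(d_1, ..., d_m)). *)
Definition multi_exponents :
    {set {dffun forall i : 'I_m, (n i).+1.-tuple 'I_(d i).+1}} :=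
  [set e : {dffun forall i : 'I_m, (n i).+1.-tuple 'I_(d i).+1} |
    [forall i, (\sum_(a <- e i) a)%N == d i]].

Lemma card_multi_exponents :
  #|multi_exponents| = (\prod_(i < m) 'C(n i + d i, d i))%N.
Proof.
pose B i := [pred t : (n i).+1.-tuple 'I_(d i).+1 |
              (\sum_(a <- t) a)%N == d i].
transitivity #|(family B : simpl_pred {dffun forall i, (n i).+1.-tuple 'I_(d i).+1})|.
  apply: eq_card => e; rewrite inE; apply/forallP/familyP => h i;
    by have := h i; rewrite inE.
rewrite card_family foldrE big_map big_enum /=; apply: eq_bigr => i _.
rewrite -[RHS]bin_sub ?leq_addl // addnK -card_ord_partitions.
by apply: eq_card => t; rewrite !inE.
Qed.

Definition segre_veronese_map (y : forall i : 'I_m, 'rV[k]_(n i).+1)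
    (l : 'I_#|multi_exponents|) : k :=
  \prod_(i < m) \prod_(j < (n i).+1) y i 0 j ^+ tnth (enum_val l i) j.

Definition segre_veronese (v : 'I_#|multi_exponents| -> k) : Prop :=
  exists (y : forall i, 'rV[k]_(n i).+1) (c : k),
    [/\ forall i, y i != 0, c != 0 &
        forall l, v l = c * segre_veronese_map y l].

End SegreVeronese.

Arguments segre_veronese k {m} n d v.

(* The minimum of f over the elements satisfying P, when there are any: the
   default value of the iteration is the maximum of f. *)
Definition min_over (T : finType) (P : pred T) (f : T -> nat) : nat :=
  \big[minn/(\max_(t | P t) f t)%N]_(t | P t) f t.

Lemma min_overP (T : finType) (P : pred T) (f : T -> nat) t0 : P t0 ->
  (exists2 t, P t & min_over P f = f t) /\
  forall t, P t -> (min_over P f <= f t)%N.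
Proof.
move=> Pt0; have le t : P t -> (min_over P f <= f t)%N.
  rewrite /min_over => Pt; have := mem_index_enum t.
  elim: index_enum (\max_(_ | _) _)%N => // s r IHr x; rewrite inE big_cons.
  case/predU1P => [<- | /IHr le_r]; first by rewrite Pt geq_minl.
  by case: ifP => // _; rewrite geq_min le_r orbT.
split=> //.
rewrite /min_over; elim/big_ind: _ => [|a b [s Ps ->] [t Pt ->]|t Pt].
- by have [t Pt ->] := eq_bigmax_cond f (introT card_gt0P (ex_intro _ t0 Pt0));
     exists t.
- by rewrite /minn; case: ifP => _; [exists s | exists t].
- by exists t.
Qed.

(* Main.v *)
(* N_{2,q} forces every Koszul cycle with quadratic coefficients over S/I, in
   homological degree at most q, to be a boundary.  A cycle that is not a
   boundary comes from a closed lattice path e_0, ..., e_L = e_0 of exponents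
   whose steps lie on edges of the polytope of all exponents, that is, from a
   degenerate elliptic normal curve of degree L in X: the boundary of the
   rectangle [0,a] x [0,b] with a, b >= 2 and L = 2(a+b), or the hexagon of
   edges of the box [0,1] x [0,1] x [0,d] that avoids two opposite vertices,
   with L = 2d+4.  Let B be the set of points of the path.  The signed sum over
   s of the coefficient of weight e_s + e_{s+1} at B \ {e_s, e_{s+1}} is a
   functional on Koszul chains that vanishes on I and, since the steps lie on
   edges, on boundaries.  On the other hand, replacing the corner e_0 by
   c' = e_1 + e_{L-1} - e_0 turns B into a disjoint union of a set F1 that may
   be translated by e_0 - e_1 and a set F2 that may be translated by
   e_0 - e_{L-1}; contracting the basis vector of F1 u F2 with the two
   translation covectors gives a cycle on which the functional is 1 or -1.
   Hence Tor_{L-3}(I) is nonzero in degree L. *)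
Require Import Defs.
From HB Require Import structures.
From mathcomp Require Import all_boot all_order all_algebra.
From mathcomp Require Import zify.

Set Implicit Arguments.
Unset Strict Implicit.
Unset Printing Implicit Defensive.

Import GRing.Theory.
Local Open Scope ring_scope.

(** * Exterior algebra: wedges, contractions by covectors and homotopies *)

Section Exterior.
Variables (n : nat) (R : comNzRingType).

(* [c T] is the coefficient of the basis vector [e_T] in an element [c] of the
   exterior algebra on [n] generators with coefficients in [V]. *)
Definition chain (V : lmodType R) := {ffun {set 'I_n} -> V}.
HB.instance Definition _ V := GRing.Lmodule.on (chain V).

(** The exponent of the sign that brings [e_x] to its place in the increasing product [e_T]. *)
Definition rank_in (T : {set 'I_n}) (x : 'I_n) := #|[set y in T | (y < x)%N]|.

Lemma rank_inU1 (T : {set 'I_n}) (x y : 'I_n) :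
  y \notin T -> rank_in (y |: T) x = ((y < x) + rank_in T x)%N.
Proof.
move=> yT; rewrite /rank_in; case: ltnP => yx.
  rewrite (_ : [set _ in _ | _] = y |: [set z in T | (z < x)%N]).
    by rewrite cardsU1 !inE (negbTE yT).
  by apply/setP => z; rewrite !inE; case: eqP => // ->; rewrite yx.
apply: eq_card => z; rewrite !inE.
by case: eqP => // ->; rewrite ltnNge yx /= !andbF.
Qed.

Lemma rank_inD1 (T : {set 'I_n}) (x : 'I_n) : rank_in (T :\ x) x = rank_in T x.
Proof.
apply: eq_card => z; rewrite !inE.
by case: eqP => // ->; rewrite ltnn !andbF.
Qed.

Section Operators.
Variable V : lmodType R.
Implicit Types (c : chain V) (x y : 'I_n) (T : {set 'I_n}).

Lemma chainD c1 c2 T : (c1 + c2) T = c1 T + c2 T. Proof. by rewrite ffunE. Qed.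
Lemma chainN c T : (- c) T = - c T. Proof. by rewrite ffunE. Qed.
Lemma chainB c1 c2 T : (c1 - c2) T = c1 T - c2 T.
Proof. by rewrite chainD chainN. Qed.
Lemma chainZ a c T : (a *: c) T = a *: c T. Proof. by rewrite ffunE. Qed.
Lemma chain0 T : (0 : chain V) T = 0. Proof. by rewrite ffunE. Qed.

Definition contract x c : chain V :=
  [ffun T : {set 'I_n} => if x \in T then 0 else (-1) ^+ rank_in T x *: c (x |: T)].

Definition wedge x c : chain V :=
  [ffun T : {set 'I_n} => if x \in T then (-1) ^+ rank_in T x *: c (T :\ x) else 0].

Lemma contractE x c T :
  contract x c T = if x \in T then 0 else (-1) ^+ rank_in T x *: c (x |: T).
Proof. by rewrite ffunE. Qed.

Lemma wedgeE x c T :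
  wedge x c T = if x \in T then (-1) ^+ rank_in T x *: c (T :\ x) else 0.
Proof. by rewrite ffunE. Qed.

Opaque contract wedge.

Lemma contract_is_linear x : linear (contract x).
Proof.
move=> a c1 c2; apply/ffunP => T; rewrite chainD chainZ !contractE !chainD !chainZ.
case: ifP => _.
  by rewrite scaler0 addr0.
by rewrite scalerDr !scalerA [a * _]mulrC.
Qed.

Lemma wedge_is_linear x : linear (wedge x).
Proof.
move=> a c1 c2; apply/ffunP => T; rewrite chainD chainZ !wedgeE !chainD !chainZ.
case: ifP => _; last first.
  by rewrite scaler0 addr0.
by rewrite scalerDr !scalerA [a * _]mulrC.
Qed.

HB.instance Definition _ x :=
  GRing.isLinear.Build R (chain V) (chain V) _ (contract x) (contract_is_linear x).
HB.instance Definition _ x :=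
  GRing.isLinear.Build R (chain V) (chain V) _ (wedge x) (wedge_is_linear x).

Lemma wedgeD x c1 c2 : wedge x (c1 + c2) = wedge x c1 + wedge x c2.
Proof. exact: linearD. Qed.

Lemma contractK x c : contract x (contract x c) = 0.
Proof.
by apply/ffunP => T; rewrite !contractE setU11 scaler0 if_same chain0.
Qed.

Lemma contractC x y c : contract x (contract y c) = - contract y (contract x c).
Proof.
have [->|xy] := eqVneq x y; first by rewrite contractK oppr0.
apply/ffunP => T; rewrite chainN !contractE !inE (eq_sym y x) (negbTE xy) /=.
case: ifPn => xT; case: ifPn => yT; rewrite ?scaler0 ?oppr0 //.
rewrite !scalerA -scaleNr setUCA; congr (_ *: _).
rewrite -!exprD !rank_inU1 // -signr_odd -[in RHS]signr_odd !oddD.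
have [lt_xy|lt_yx|/val_inj e] := ltngtP x y; last by rewrite e eqxx in xy.
  by case: (odd (rank_in T x)); case: (odd (rank_in T y));
  rewrite /= ?expr0 ?expr1 ?opprK.
by case: (odd (rank_in T x)); case: (odd (rank_in T y));
  rewrite /= ?expr0 ?expr1 ?opprK.
Qed.

(** The Clifford relation. For distinct [x] and [y] both sides pick the same coefficient; inserting
    the smaller index raises the rank of the larger by one, hence the sign. *)
Lemma wedge_contract x y c :
  wedge x (contract y c) = (if x == y then c else 0) - contract y (wedge x c).
Proof.
apply/ffunP => T; rewrite chainB wedgeE !contractE wedgeE.
have [<-|xy] := eqVneq x y.
  rewrite !inE !eqxx /= !scalerA.
  case: ifPn => xT.
    by rewrite setD1K // rank_inD1 subr0 -expr2 sqrr_sign scale1r.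
  have -> : (x |: T) :\ x = T by rewrite setU1K.
  by rewrite rank_inU1 // ltnn -expr2 sqrr_sign scale1r subrr.
rewrite chain0 sub0r !inE (eq_sym y x) (negbTE xy) /=.
case: ifPn => xT; case: ifPn => yT; rewrite ?scaler0 ?oppr0 //.
rewrite !scalerA -scaleNr.
have -> : (y |: T) :\ x = y |: T :\ x.
  by apply/setP=> z; rewrite !inE; case: (eqVneq z y) => // ->; rewrite eq_sym xy.
congr (_ *: _); rewrite -[T in LHS](setD1K xT) -[T in RHS](setD1K xT).
set U := T :\ x; have xU : x \notin U by rewrite !inE eqxx.
have yU : y \notin U by rewrite !inE (negbTE yT) andbF.
have -> : (x |: U) :\ x = U by rewrite setU1K.
rewrite setUCA !rank_inU1 ?inE ?negb_or ?xU ?yU ?(eq_sym y x) ?andbT ?xy ?eqxx //.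
rewrite -!exprD -signr_odd -[in RHS]signr_odd !oddD ltnn /=.
have [lt_xy|lt_yx|/val_inj e] := ltngtP x y; last by rewrite e eqxx in xy.
  by case: (odd (rank_in U x)); case: (odd (rank_in U y));
  rewrite /= ?expr0 ?expr1 ?opprK.
by case: (odd (rank_in U x)); case: (odd (rank_in U y));
  rewrite /= ?expr0 ?expr1 ?opprK.
Qed.

Definition contr (l : 'I_n -> R) c : chain V := \sum_x l x *: contract x c.

Lemma contr_is_linear l : linear (contr l).
Proof.
move=> a c1 c2; rewrite /contr scaler_sumr -big_split /=; apply: eq_bigr => x _.
by rewrite linearP scalerDr !scalerA [a * _]mulrC.
Qed.
HB.instance Definition _ l :=
  GRing.isLinear.Build R (chain V) (chain V) _ (contr l) (contr_is_linear l).

Lemma contrD l c1 c2 : contr l (c1 + c2) = contr l c1 + contr l c2.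
Proof. exact: linearD. Qed.

Lemma contrB l c1 c2 : contr l (c1 - c2) = contr l c1 - contr l c2.
Proof. exact: linearB. Qed.

Lemma contr0 l : contr l 0 = 0.
Proof. exact: linear0. Qed.

Lemma contrE l c T :
  contr l c T = \sum_(x | x \notin T) (l x * (-1) ^+ rank_in T x) *: c (x |: T).
Proof.
rewrite /contr sum_ffunE [RHS]big_mkcond; apply: eq_bigr => x _.
by rewrite chainZ contractE; case: ifP; rewrite ?scaler0 ?scalerA.
Qed.

Lemma contr_contr l1 l2 c :
  contr l1 (contr l2 c) = \sum_x \sum_y (l1 x * l2 y) *: contract x (contract y c).
Proof.
rewrite {1}/contr; apply: eq_bigr => x _; rewrite /contr linear_sum scaler_sumr.
by apply: eq_bigr => y _; rewrite linearZ scalerA.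
Qed.

Lemma contrC l1 l2 c : contr l1 (contr l2 c) = - contr l2 (contr l1 c).
Proof.
rewrite !contr_contr exchange_big -sumrN; apply: eq_bigr => x _.
rewrite -sumrN; apply: eq_bigr => y _.
by rewrite contractC scalerN mulrC.
Qed.

(* Splitting the double sum at the diagonal avoids dividing by 2. *)
Lemma contr_sym l1 l2 c :
  (forall x y, l1 x * l2 y = l1 y * l2 x) -> contr l1 (contr l2 c) = 0.
Proof.
move=> sym; rewrite contr_contr.
rewrite (eq_bigr (fun x : 'I_n =>
  \sum_(y < n | (y < x)%N) (l1 x * l2 y) *: contract x (contract y c) +
  \sum_(y < n | (x < y)%N) (l1 x * l2 y) *: contract x (contract y c))).
  rewrite big_split /= [X in _ + X](exchange_big_dep predT) //= -big_split /=.
  apply: big1 => x _; rewrite -big_split /=; apply: big1 => y _.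
  by rewrite contractC scalerN sym addNr.
move=> x _; rewrite (bigID (fun y : 'I_n => (y < x)%N)) /=; congr (_ + _).
rewrite (bigD1 x) ?ltnn //= contractK scaler0 add0r; apply: eq_bigl => y.
by rewrite -leqNgt ltn_neqAle eq_sym andbC.
Qed.

Lemma wedge_contr x l c : wedge x (contr l c) = l x *: c - contr l (wedge x c).
Proof.
rewrite /contr linear_sum /= (bigD1 x) //= [in RHS](bigD1 x) //= linearZ /=.
rewrite wedge_contract eqxx scalerBr opprD addrA; congr (_ + _).
rewrite -sumrN; apply: eq_bigr => y ne_yx.
by rewrite linearZ /= wedge_contract eq_sym (negbTE ne_yx) sub0r scalerN.
Qed.

Lemma wedge_contractK x c T : contract x (wedge x c) T = if x \in T then 0 else c T.
Proof.
rewrite contractE wedgeE setU11; case: ifPn => // xT; rewrite setU1K // scalerA.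
by rewrite rank_inU1 // ltnn -expr2 sqrr_sign scale1r.
Qed.

Lemma wedge2_contr x y l c :
  wedge y (wedge x (contr l c)) =
  l x *: wedge y c - l y *: wedge x c + contr l (wedge y (wedge x c)).
Proof.
by rewrite wedge_contr linearB linearZ /= wedge_contr opprB addrA addrAC.
Qed.

Lemma wedge2E x y c (T : {set 'I_n}) : x != y -> x \in T -> y \in T ->
  exists b : bool, wedge y (wedge x c) T = (-1) ^+ b *: c ((T :\ y) :\ x).
Proof.
move=> xy xT yT; rewrite !wedgeE yT !inE xy xT scalerA -exprD.
by exists (odd (rank_in T y + rank_in (T :\ y) x)); rewrite signr_odd.
Qed.

Definition single (U : {set 'I_n}) (v : V) : chain V :=
  [ffun T : {set 'I_n} => if T == U then v else 0].

Lemma singleE U v T : single U v T = if T == U then v else 0.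
Proof. by rewrite ffunE. Qed.

Lemma contr_supp (P Q : pred {set 'I_n}) l c :
  (forall (T : {set 'I_n}) x, x \notin T -> P (x |: T) -> Q T) ->
  (forall T, ~~ P T -> c T = 0) -> forall T, ~~ Q T -> contr l c T = 0.
Proof.
move=> PQ c0 T nQ; rewrite contrE big1 // => x xT.
by rewrite c0 ?scaler0 //; apply: contra nQ; apply: PQ.
Qed.

Lemma contr_single0 l (U : {set 'I_n}) v :
  (forall x, x \in U -> l x = 0) -> contr l (single U v) = 0.
Proof.
move=> l0; apply/ffunP => T; rewrite contrE chain0 big1 // => x _.
rewrite singleE; case: eqP => [e|_]; last by rewrite scaler0.
by rewrite l0 ?mul0r ?scale0r // -e setU11.
Qed.

Lemma contr2_supp l1 l2 (U : {set 'I_n}) v T :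
  ~~ ((T \subset U) && (#|T|.+2 == #|U|)) ->
  contr l1 (contr l2 (single U v)) T = 0.
Proof.
have sub (A : {set 'I_n}) x : x |: A \subset U -> A \subset U.
  by apply: subset_trans; apply: subsetUr.
move: T; apply: (contr_supp (P := fun A => (A \subset U) && (#|A|.+1 == #|U|))).
  by move=> A x xA /andP[/sub -> /eqP <-]; rewrite cardsU1 xA /= add1n.
apply: (contr_supp (P := pred1 U)) => A.
  by move=> x xA /eqP def_U; rewrite (sub A x) -def_U // cardsU1 xA /= add1n.
by rewrite singleE => /negbTE /= ->.
Qed.

(** Up to sign the coefficient is the 2 by 2 minor of [l1], [l2] in the columns [x], [y]; [l1 y = 0]
    leaves one of its two products. *)
Lemma contr2_single l1 l2 x y T v : x \notin T -> y \notin x |: T -> l1 y = 0 ->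
  exists b : bool, contr l1 (contr l2 (single (y |: (x |: T)) v)) T =
    ((-1) ^+ b * (l1 x * l2 y)) *: v.
Proof.
move=> xT yT l1y; have [yx yT'] : y != x /\ y \notin T.
  by move: yT; rewrite !inE negb_or => /andP.
exists (odd (rank_in T x + rank_in (x |: T) y)); rewrite signr_odd exprD.
rewrite contrE (bigD1 x) //= big1 ?addr0; last first.
  move=> w /andP[wT wx]; have [->|wy] := eqVneq w y.
    by rewrite l1y mul0r scale0r.
  rewrite contrE big1 ?scaler0 // => u _; rewrite singleE.
  case: eqP => [/setP/(_ w)|_]; last by rewrite scaler0.
  by rewrite !inE eqxx orbT (negbTE wx) (negbTE wy) (negbTE wT).
rewrite contrE (bigD1 y) //= big1 ?addr0; last first.
  move=> w /andP[wT wy]; rewrite singleE.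
  case: eqP => [/setP/(_ w)|_]; last by rewrite scaler0.
  by move: wT; rewrite !inE eqxx (negbTE wy) /= => /negbTE ->.
rewrite singleE eqxx scalerA; congr (_ *: _).
by rewrite mulrACA mulrC.
Qed.

(* Off [U] the outer covector is invisible to [single U v]; on [F1] and [F2] it
   is proportional to [l1], resp. [l2]. *)
Lemma contr3_single0 (F1 F2 : {set 'I_n}) l l1 l2 v : [disjoint F1 & F2] ->
  (forall x, x \notin F1 -> l1 x = 0) -> (forall x, x \notin F2 -> l2 x = 0) ->
  {in F1 &, forall x y, l x * l1 y = l y * l1 x} ->
  {in F2 &, forall x y, l x * l2 y = l y * l2 x} ->
  contr l (contr l1 (contr l2 (single (F1 :|: F2) v))) = 0.
Proof.
move=> dis l1_0 l2_0 sym1 sym2.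
pose lr (F : {set 'I_n}) x := if x \in F then l x else 0.
have lE x : l x = lr F1 x + (lr F2 x + lr (~: (F1 :|: F2)) x).
  rewrite /lr !inE; case: (boolP (x \in F1)) => [/(disjointFr dis) ->|] /=.
    by rewrite !addr0.
  by case: (x \in F2); rewrite /= ?addr0 ?add0r.
have contr_split c :
    contr l c = contr (lr F1) c + (contr (lr F2) c + contr (lr (~: (F1 :|: F2))) c).
  rewrite /contr -!big_split; apply: eq_bigr => x _ /=.
  by rewrite -!scalerDl -lE.
have lr_sym (F : {set 'I_n}) m (m0 : forall x, x \notin F -> m x = 0) :
    {in F &, forall x y, l x * m y = l y * m x} ->
    forall x y, lr F x * m y = lr F y * m x.
  move=> sym x y; rewrite /lr; case: ifPn => xF; case: ifPn => yF.
  - exact: sym.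
  - by rewrite (m0 y yF) mulr0 mul0r.
  - by rewrite (m0 x xF) mulr0 mul0r.
  - by rewrite !mul0r.
rewrite contr_split [contr (lr F1) _]contr_sym; last exact: lr_sym l1_0 sym1.
rewrite [contr (lr F2) _]contrC [contr (lr F2) _]contr_sym; last first.
  exact: lr_sym l2_0 sym2.
(* The part of [l] outside [F1 :|: F2] is moved innermost, where it meets [single] directly. *)
rewrite contr0 oppr0 !add0r contrC (contrC _ l2) contr_single0.
  by rewrite contr0 oppr0 contr0 oppr0.
by move=> x xU; rewrite /lr inE xU.
Qed.

(* [D] is division by [l x] with remainder, so [wedge x] after [D] is a homotopy
   from the identity to the projection that kills [l x] and [e_x]. *)
Section Homotopy.
Variables (l : 'I_n -> R) (x : 'I_n) (D : {additive V -> V}).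
Hypothesis D_l : forall y v, D (l y *: v) = if y == x then v else l y *: D v.

Definition map_chain c : chain V := [ffun T => D (c T)].

Lemma map_chainE c T : map_chain c T = D (c T).
Proof. by rewrite ffunE. Qed.

Lemma map_chain_contract y c : map_chain (contract y c) = contract y (map_chain c).
Proof.
apply/ffunP => T; rewrite map_chainE !contractE map_chainE.
case: ifP => _; first by rewrite raddf0.
by rewrite -signr_odd; case: (odd _); rewrite ?scaleN1r ?scale1r ?raddfN.
Qed.

Lemma contr_homotopy c : contr l c = 0 ->
  c - contr l (wedge x (map_chain c)) =
  [ffun T : {set 'I_n} => if x \in T then 0 else c T - l x *: D (c T)].
Proof.
move=> c0; set d := map_chain c.
have kd : contr l d = contract x (l x *: d - c).
  (* Apply [D] to [contr l c = 0]: by [D_l] it strips [l x] from the summand at [x] and passes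
     through the others. *)
  have e : contract x c + \sum_(y | y != x) l y *: contract y d = 0.
    apply/ffunP => T; have e0 : D (contr l c T) = 0 by rewrite c0 chain0 raddf0.
    rewrite chain0 -[RHS]e0 /contr [in RHS](bigD1 x) //= !chainD raddfD chainZ D_l eqxx.
    congr (_ + _).
    rewrite !sum_ffunE raddf_sum; apply: eq_bigr => y ne.
    by rewrite !chainZ D_l (negbTE ne) -map_chainE map_chain_contract.
  rewrite /contr (bigD1 x) //= linearB linearZ /=; congr (_ + _).
  by apply/eqP; rewrite -addr_eq0 addrC e.
have kw : contr l (wedge x d) =
    l x *: d - ((l x *: d - c) - contract x (wedge x (l x *: d - c))).
  have := wedge_contract x x (l x *: d - c); rewrite -kd eqxx => <-.
  by rewrite wedge_contr opprB addrC subrK.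
rewrite kw; apply/ffunP => T; rewrite [RHS]ffunE !chainB wedge_contractK !chainB.
rewrite chainZ map_chainE.
case: ifP => _; last by rewrite subrr subr0.
by rewrite subr0 subKr subrr.
Qed.

End Homotopy.
End Operators.
End Exterior.

Lemma map_mx_contr n (R R' : comNzRingType) (f : {rmorphism R -> R'}) r
    (l : 'I_n -> R) (c : chain n 'rV[R]_r) (c' : chain n 'rV[R']_r) :
  (forall T, map_mx f (c T) = c' T) ->
  forall T, map_mx f (contr l c T) = contr (fun x => f (l x)) c' T.
Proof.
move=> cc' T; rewrite !contrE map_mx_sum; apply: eq_bigr => x _.
by rewrite map_mxZ cc' rmorphM rmorph_sign.
Qed.

(** * The functional of a lattice cycle and the cycle that detects it *)

Section CyclicForm.
Variables (n : nat) (R : comNzRingType) (A : nzRingType).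
Variables (X : 'I_n -> R).
(* In the application [coef1 x] and [coef2 x y] extract the coefficients whose
   toric weights are those of [X x] and of [X x * X y]. *)
Variables (coef1 : 'I_n -> {additive R -> A})
  (coef2 : 'I_n -> 'I_n -> {additive R -> A}).
Local Notation chain := (chain n 'rV[R]_1).

Variables (e : nat -> 'I_n) (L : nat) (B : {set 'I_n}).

(** The two wedges read off, with its sign, the coefficient at [B] without [e s] and [e s.+1]; in
    this form [wedge2_contr] yields the telescoping. *)
Definition cyclic_form (c : chain) : A :=
  \sum_(0 <= s < L) coef2 (e s) (e s.+1) (wedge (e s.+1) (wedge (e s) c) B 0 0).

Lemma cyclic_formD c1 c2 : cyclic_form (c1 + c2) = cyclic_form c1 + cyclic_form c2.
Proof.
rewrite -big_split; apply: eq_bigr => s _ /=.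
by rewrite !wedgeD chainD mxE raddfD.
Qed.

Lemma additive_sign (h : {additive R -> A}) (i : nat) f :
  h ((-1) ^+ i * f) = (-1) ^+ i * h f.
Proof.
by rewrite -signr_odd -[in RHS]signr_odd; case: (odd i);
  rewrite ?mulN1r ?mul1r ?raddfN.
Qed.

Lemma cyclic_form0 (c : chain) :
  (forall x y T, coef2 x y (c T 0 0) = 0) -> cyclic_form c = 0.
Proof.
move=> c0; apply: big1 => s _; rewrite !wedgeE.
case: ifP => _; last by rewrite mxE raddf0.
case: ifP => _; last by rewrite scaler0 mxE raddf0.
by rewrite scalerA -exprD mxE additive_sign c0 mulr0.
Qed.

Hypothesis coef2l : forall x y f, coef2 x y (X x * f) = coef1 y f.
Hypothesis coef2r : forall x y f, coef2 x y (X y * f) = coef1 x f.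

(* The sum telescopes along the cycle. *)
Lemma cyclic_form_contr u :
  (forall s w f, (s < L)%N -> w \notin B -> coef2 (e s) (e s.+1) (X w * f) = 0) ->
  e L = e 0%N -> cyclic_form (contr X u) = 0.
Proof.
move=> closed eL; pose a s := coef1 (e s) (wedge (e s) u B 0 0).
rewrite /cyclic_form (eq_big_nat _ _ (F2 := fun s => a s.+1 - a s)).
  by rewrite telescope_sumr // /a eL subrr.
(* The first two terms of [wedge2_contr] give [a s.+1 - a s]; the third is a combination of the
   [X w] with [w] outside [B], killed by [closed]. *)
move=> s /andP[_ sL]; rewrite wedge2_contr !chainD chainN !chainZ.
rewrite !mxE !raddfD raddfN /= coef2l coef2r -[RHS]addr0.
congr (_ + _); rewrite contrE summxE raddf_sum big1 //= => w wB.
by rewrite mxE -mulrA closed.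
Qed.

Section ShiftCycle.
Variables (F1 F2 : {set 'I_n}) (a b : 'I_n -> 'I_n).
Hypothesis disF : [disjoint F1 & F2].

Definition shift_covector (F : {set 'I_n}) (h : 'I_n -> 'I_n) x : R :=
  if x \in F then X (h x) else 0.

Definition shift_cycle : chain :=
  contr (shift_covector F1 a)
    (contr (shift_covector F2 b) (single (F1 :|: F2) (const_mx 1))).

Lemma shift_covector0 (F : {set 'I_n}) h x : x \notin F -> shift_covector F h x = 0.
Proof. by rewrite /shift_covector => /negbTE ->. Qed.

(** After [f], the covector [X] is proportional on [F1] to its shift by [a] and on [F2] to its shift
    by [b], the situation of [contr3_single0]. In the application [f] is evaluation at a point of
    the variety. *)
Lemma contr_shift_cycle (R' : comNzRingType) (f : {rmorphism R -> R'}) T :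
  {in F1 &, forall x y, f (X x) * f (X (a y)) = f (X y) * f (X (a x))} ->
  {in F2 &, forall x y, f (X x) * f (X (b y)) = f (X y) * f (X (b x))} ->
  f (contr X shift_cycle T 0 0) = 0.
Proof.
move=> sym_a sym_b; have -> (u : 'rV[R]_1) : f (u 0 0) = map_mx f u 0 0.
  by rewrite mxE.
have map_single (U C : {set 'I_n}) : map_mx f (single U (const_mx 1 : 'rV[R]_1) C) =
    single U (const_mx 1 : 'rV[R']_1) C.
  by rewrite !singleE; case: eqP => _; apply/rowP => i; rewrite !mxE ?rmorph1 ?rmorph0.
rewrite (map_mx_contr _ (map_mx_contr _ (map_mx_contr _ (map_single _)))).
rewrite contr3_single0 ?chain0 ?mxE //.
- by move=> x /shift_covector0 ->; rewrite rmorph0.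
- by move=> x /shift_covector0 ->; rewrite rmorph0.
- by move=> x y xF yF; rewrite /shift_covector xF yF sym_a.
- by move=> x y xF yF; rewrite /shift_covector xF yF sym_b.
Qed.

Variable c' : 'I_n.
Hypothesis L_ge3 : (3 <= L)%N.
Hypothesis eL : e L = e 0%N.
Hypothesis eB : forall s, (s < L)%N -> e s \in B.
Hypothesis e_simple : forall s, (0 < s < L)%N -> e s != e 0%N.
Hypothesis F12 : F1 :|: F2 = c' |: B :\ e 0%N.
Hypothesis c'B : c' \notin B.
Hypothesis c'F2 : c' \in F2.
Hypothesis e1F1 : e 1%N \in F1.
Hypothesis eL1F2 : e L.-1 \in F2.
Hypothesis corner : coef2 (e 0%N) (e 1%N) (X (a (e 1%N)) * X (b c')) = 1.

(* Only the two edges at the corner [e 0] can contribute, and the second one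
   does not since neither of its ends lies in [F1]. *)
Lemma cyclic_form_shift_cycle : exists i : bool, cyclic_form shift_cycle = (-1) ^+ i.
Proof.
have c'F1 : shift_covector F1 a c' = 0.
  by rewrite shift_covector0 // (disjointFl disF c'F2).
have e0B : e 0%N \in B by apply/eB/(leq_trans _ L_ge3).
have e0U : e 0%N \notin F1 :|: F2.
  by rewrite F12 !inE eqxx /= orbF; apply: contraNneq c'B => <-.
(* Removing [o] and [c'] from [F1 :|: F2] leaves this set; since [c'] is not in [F1], only one
   product of the minor survives. *)
have pair (o : 'I_n) : o \in B -> o != e 0%N -> exists i : bool,
    shift_cycle ((B :\ o) :\ e 0%N) =
    ((-1) ^+ i * (shift_covector F1 a o * shift_covector F2 b c')) *: const_mx 1.
  move=> oB o0; set T := _ :\ e 0%N.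
  have oT : o \notin T by rewrite !inE eqxx andbF.
  have c'T : c' \notin o |: T.
    rewrite !inE (negbTE c'B) !andbF orbF.
    by apply: contraNneq c'B => ->.
  have [i def_z] :=
    contr2_single (shift_covector F2 b) (const_mx 1 : 'rV[R]_1) oT c'T c'F1.
  exists i; rewrite /shift_cycle.
  suff -> : F1 :|: F2 = c' |: (o |: T) by exact: def_z.
  have -> : T = B :\ e 0%N :\ o by apply/setP => x; rewrite !inE andbCA.
  by rewrite F12 setD1K // !inE oB o0.
have e1 : e 1%N != e 0%N by apply/e_simple/(leq_trans _ L_ge3).
have e1B : e 1%N \in B by apply/eB/(leq_trans _ L_ge3).
have [i def_i] := wedge2E shift_cycle (etrans (congr1 negb (eq_sym _ _)) e1) e0B e1B.
have [j def_j] := pair _ e1B e1.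
exists (i (+) j); rewrite /cyclic_form big_ltn ?(leq_trans _ L_ge3) //.
rewrite big_nat big1 ?addr0 => [|s /andP[s_gt0 sL]].
  rewrite def_i def_j scalerA !mxE mulr1 mulrA -exprD additive_sign.
  by rewrite /shift_covector e1F1 c'F2 corner mulr1 -signr_odd oddD !oddb.
have s_e0 : e s != e 0%N by apply: e_simple; rewrite s_gt0.
have sB : e s \in B by apply: eB.
suff -> : wedge (e s.+1) (wedge (e s) shift_cycle) B = 0 by rewrite mxE raddf0.
have [sL' | Ls] := ltnP s.+1 L.
  rewrite !wedgeE; case: ifP => // _; case: ifP => _; last by rewrite scaler0.
  (* The set still contains [e 0], which is not in [F1 :|: F2], so it lies outside the support of
     the cycle. *)
  rewrite [shift_cycle _]contr2_supp; first by rewrite !scaler0.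
  apply: contra e0U => /andP[/subsetP sub _]; apply: sub.
  by rewrite !inE e0B !(eq_sym (e 0%N)) s_e0 e_simple.
have def_L : s.+1 = L by apply/eqP; rewrite eqn_leq sL Ls.
have es1 : e s.+1 = e 0%N by rewrite def_L.
rewrite es1; have [i' ->] := wedge2E shift_cycle s_e0 sB e0B.
have [j' e_j'] := pair _ sB s_e0.
rewrite (_ : B :\ e 0%N :\ e s = B :\ e s :\ e 0%N); last first.
  by apply/setP => x; rewrite !inE andbCA.
rewrite e_j' /shift_covector.
have -> : s = L.-1 by rewrite -def_L.
by rewrite (disjointFl disF eL1F2) mul0r mulr0 scale0r scaler0.
Qed.

End ShiftCycle.
End CyclicForm.

(** * Exactness of the Koszul complex of the variables *)

Section Koszul.
Variables (n : nat) (k : fieldType).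
Local Notation S := {mpoly k[n]}.

Lemma mcoeff_XM (i : 'I_n) (f : S) m :
  ('X_i * f)@_m = if (0 < m i)%N then f@_(m - U_(i)) else 0.
Proof.
case: ifPn => mi.
  have /submK {1}<- : (U_(i) <= m)%MM.
    by apply/mnm_lepP => j; rewrite mnm1E; case: eqP => // <-.
  by rewrite mulrC addmC mcoeffMX.
rewrite mulrC; apply/eqP; rewrite mcoeff_eq0 (perm_mem (msuppMX _ _)).
apply/mapP => -[m' _ e]; move: mi; rewrite e mnmDE mnm1E eqxx.
by rewrite lt0n.
Qed.

(* [f = f|_{X_i = 0} + X_i * mdrop i f] *)
Definition mdrop (i : 'I_n) (f : S) : S :=
  \sum_(m <- msupp f | (0 < m i)%N) f@_m *: 'X_[m - U_(i)].

Lemma mcoeff_mdrop i f m : (mdrop i f)@_m = f@_(m + U_(i)).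
Proof.
rewrite /mdrop raddf_sum /=.
have mUi : (m + U_(i))%MM i != 0 by rewrite mnmDE mnm1E eqxx addn1.
rewrite (eq_bigr (fun m' => f@_m' * (m' == m + U_(i))%MM%:R)); last first.
  move=> m' m'i; rewrite mcoeffZ mcoeffX; congr (_ * _%:R).
  have le : (U_(i) <= m')%MM.
    by apply/mnm_lepP => j; rewrite mnm1E; case: eqP => // <-.
  by rewrite -(eqm_add2r U_(i)) submK.
have [mf|mf] := boolP ((m + U_(i))%MM \in msupp f).
  rewrite -big_filter (bigD1_seq (m + U_(i))%MM) ?filter_uniq ?msupp_uniq //=.
    rewrite eqxx mulr1 big1 ?addr0 // => m' /negbTE ->.
    by rewrite mulr0.
  by rewrite mem_filter lt0n mUi.
rewrite (memN_msupp_eq0 mf) big_seq_cond big1 // => m' /andP[m'f _].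
by case: eqP => [e|_]; rewrite ?mulr0 //; move: mf; rewrite -e m'f.
Qed.

Lemma mdrop_is_additive i : additive (mdrop i).
Proof. by move=> f g; apply/mpolyP => m; rewrite mcoeffB !mcoeff_mdrop mcoeffB. Qed.
HB.instance Definition _ i :=
  GRing.isAdditive.Build S S (mdrop i) (mdrop_is_additive i).

Lemma mdropXM i x f :
  mdrop i ('X_x * f) = if x == i then f else 'X_x * mdrop i f.
Proof.
apply/mpolyP => m; rewrite mcoeff_mdrop mcoeff_XM mnmDE mnm1E eq_sym.
case: eqP => [->|/eqP ne]; first by rewrite addn1 addmK.
rewrite mcoeff_XM addn0; case: ifP => // xm; rewrite mcoeff_mdrop.
by congr (_@_ _); apply/mnmP => j; rewrite !(mnmBE, mnmDE, mnm1E);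
  case: (eqVneq x j) xm ne => [->|]; case: (eqVneq i j) => //=; lia.
Qed.

Variable r : nat.
Local Notation chain := (chain n 'rV[S]_r).

Definition koszul : chain -> chain := contr (fun x => 'X_x).

Lemma koszulE c : koszul c = contr (fun x => 'X_x) c. Proof. by []. Qed.
Lemma koszulD c1 c2 : koszul (c1 + c2) = koszul c1 + koszul c2.
Proof. exact: contrD. Qed.
Lemma koszulB c1 c2 : koszul (c1 - c2) = koszul c1 - koszul c2.
Proof. exact: contrB. Qed.
Lemma koszul0 : koszul 0 = 0.
Proof. exact: contr0. Qed.

Lemma koszulK c : koszul (koszul c) = 0.
Proof. by rewrite /koszul contr_sym // => x y; rewrite mulrC. Qed.

Lemma map_mx_mdropXM i x (u : 'rV[S]_r) :
  map_mx (mdrop i) ('X_x *: u) =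
  if x == i then u else 'X_x *: map_mx (mdrop i) u.
Proof.
by apply/rowP => a; rewrite !mxE mdropXM; case: eqP; rewrite ?mxE.
Qed.

Lemma koszul_const c T a : (koszul c T 0 a)@_0%MM = 0.
Proof.
rewrite koszulE contrE summxE raddf_sum big1 //= => x _.
by rewrite mxE -mulrA mcoeff_XM mnm0E.
Qed.

Opaque koszul.

(** Variables are eliminated one at a time: the homotopy for [mdrop i] subtracts a boundary and
    removes [X_i] and [e_i] without bringing back earlier variables. What survives all of them is a
    constant at [set0], zero by hypothesis. A wedge has no coefficient at [set0], whence
    [u set0 = 0]. *)
Lemma koszul_exact c : koszul c = 0 -> (forall a, (c set0 0 a)@_0%MM = 0) ->
  exists2 u : chain, u set0 = 0 & c = koszul u.
Proof.
move=> c0 cst.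
suff red (s : seq 'I_n) : exists u c' : chain, [/\ u set0 = 0, c = koszul u + c' &
    forall i (T : {set 'I_n}), i \in s -> (i \in T -> c' T = 0) /\
      forall a (m : 'X_{1..n}), (0 < m i)%N -> (c' T 0 a)@_m = 0].
  have [u [c' [u0 def_c c'0]]] := red (enum 'I_n); exists u => //.
  suff c'_0 : c' = 0 by rewrite c'_0 addr0 in def_c.
  apply/ffunP => T; rewrite chain0; have [->|[i iT]] := set_0Vmem T; last first.
    by have [->] := c'0 i T (mem_enum _ i).
  apply/rowP => a; rewrite mxE; apply/mpolyP => m; rewrite mcoeff0.
  have [->|m0] := eqVneq m 0%MM.
    by have := cst a; rewrite def_c chainD mxE mcoeffD koszul_const add0r.
  have [i mi] : exists i, (0 < m i)%N.
    apply/existsP; apply: contraR m0 => /existsPn m0; apply/eqP/mnmP => i.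
    by rewrite mnm0E; have := m0 i; case: (m i).
  by have [_ ->] := c'0 i set0 (mem_enum _ i).
elim: s => [|i s [u [c' [u0 def_c c'0]]]].
  by exists 0, c; split; rewrite ?chain0 // koszul0 add0r.
have kc' : koszul c' = 0.
  by have := c0; rewrite def_c koszulD koszulK add0r.
pose w := wedge i (map_chain (map_mx (mdrop i)) c').
exists (u + w), (c' - koszul w); split.
- by rewrite chainD u0 wedgeE in_set0 addr0.
- by rewrite koszulD addrACA [X in _ + X]subrr addr0.
move=> j T; rewrite /w koszulE (contr_homotopy (map_mx_mdropXM i)) // inE ffunE => js.
case: ifPn => iT; first by split=> // a m _; rewrite mxE mcoeff0.
case/predU1P: js => [->|js].
  split=> [iT'|a m mi]; first by case/negP: iT.
  rewrite !mxE mcoeffB mcoeff_XM mi mcoeff_mdrop submK ?subrr //.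
  by apply/mnm_lepP => l; rewrite mnm1E; case: eqP => // <-.
have [c'T c'm] := c'0 j T js; split=> [jT|a m mj].
  by rewrite c'T // raddf0 scaler0 subrr.
rewrite !mxE mcoeffB mcoeff_XM c'm // add0r; case: ifP => mi; last by rewrite oppr0.
by rewrite mcoeff_mdrop submK ?c'm ?oppr0 //;
  apply/mnm_lepP => l; rewrite mnm1E; case: eqP => // <-.
Qed.

End Koszul.

(** * Comparison of a free resolution with the Koszul complex *)

Section GradedLift.
Variables (n : nat) (k : fieldType).
Local Notation S := {mpoly k[n]}.

Lemma pihomogMr D e (f g : S) : g \is e.-homog ->
  pihomog mdeg D (f * g) = if (e <= D)%N then pihomog mdeg (D - e) f * g else 0.
Proof.
move=> hg; rewrite {1}[f]mpolyE mulr_suml raddf_sum /=.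
have hXg m : 'X_[m] * g \is (mdeg m + e).-homog.
  by apply: dhomogM hg; rewrite dhomogX.
have piX m : pihomog mdeg D ('X_[m] * g) =
    if (mdeg m + e == D)%N then 'X_[m] * g else 0.
  case: eqP => [<-|/eqP ne]; first by rewrite pihomog_dE.
  by rewrite (pihomog_ne0 _ (hXg m)) // eq_sym.
rewrite (eq_bigr (fun m => f@_m *: if (mdeg m + e == D)%N then 'X_[m] * g else 0)).
  case: leqP => [le_eD|lt_De]; last first.
    apply: big1 => m _; case: eqP => [e_m|]; rewrite ?scaler0 //; lia.
  rewrite pihomogE mulr_suml [RHS]big_mkcond; apply: eq_bigr => m _.
  rewrite -[(mdeg m == _)%N](eqn_add2r e) subnK //; case: eqP => _; rewrite ?scaler0 //.
  by rewrite scalerAl.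
by move=> m _; rewrite -scalerAl linearZ /= piX.
Qed.

(** Elements of degree [D] in the sum of the [S(- dg a)]. The test keeps truncated subtraction from
    allowing constants where the degree would be negative. *)
Definition homog_row r (dg : 'I_r -> nat) (D : nat) (u : 'rV[S]_r) :=
  forall a, if (dg a <= D)%N then u 0 a \is (D - dg a).-homog else u 0 a == 0.

Definition homog_mx r r' (dg : 'I_r -> nat) (dg' : 'I_r' -> nat) (M : 'M[S]_(r, r')) :=
  forall a b, if (dg' b <= dg a)%N then M a b \is (dg a - dg' b).-homog
              else M a b == 0.

(** Since [M] preserves degrees and the image of [w] is homogeneous of degree [D], the degree [D]
    component of [w] has the same image. *)
Lemma homog_lift r r' (dg : 'I_r -> nat) (dg' : 'I_r' -> nat) (M : 'M[S]_(r, r'))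
    D (w : 'rV[S]_r) :
  homog_mx dg dg' M -> homog_row dg' D (w *m M) ->
  exists2 w' : 'rV[S]_r, homog_row dg D w' & w' *m M = w *m M.
Proof.
move=> hM hu.
exists (\row_a (if (dg a <= D)%N then pihomog mdeg (D - dg a) (w 0 a) else 0)).
  by move=> a; rewrite mxE; case: (dg a <= D)%N => //; apply: pihomogP.
apply/rowP => b; have := hu b; rewrite !mxE.
case: leqP => [le_bD /pihomog_dE <-|lt_Db /eqP ->].
  rewrite raddf_sum; apply: eq_bigr => a _; rewrite mxE /=; have := hM a b.
  case: leqP => [le_ba /pihomogMr ->|_ /eqP ->]; last first.
    by rewrite !mulr0 raddf0.
  rewrite leq_sub2rE // subnBA // subnK //.
  by case: ifP; rewrite ?mul0r.
apply: big1 => a _; rewrite mxE; case: leqP => le_aD; last by rewrite mul0r.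
have := hM a b; rewrite leqNgt (leq_ltn_trans le_aD lt_Db) /= => /eqP ->.
by rewrite mulr0.
Qed.

End GradedLift.

Section ZigZag.
Variables (k : fieldType) (n : nat).
Local Notation S := {mpoly k[n]}.
Local Notation chain r := (chain n 'rV[S]_r).

Definition mulc r r' (M : 'M[S]_(r, r')) (c : chain r) : chain r' :=
  [ffun T => c T *m M].

Lemma mulcE r r' (M : 'M[S]_(r, r')) c T : mulc M c T = c T *m M.
Proof. by rewrite ffunE. Qed.

Lemma koszul_mulc r r' (M : 'M[S]_(r, r')) c :
  koszul (mulc M c) = mulc M (koszul c).
Proof.
apply/ffunP => T; rewrite mulcE !koszulE !contrE mulmx_suml; apply: eq_bigr => x _.
by rewrite mulcE scalemxAl.
Qed.

Lemma mulcD r r' (M : 'M[S]_(r, r')) c1 c2 :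
  mulc M (c1 + c2) = mulc M c1 + mulc M c2.
Proof. by apply/ffunP => T; rewrite chainD !mulcE chainD mulmxDl. Qed.

Opaque mulc.

Variables (I : S -> Prop) (F : graded_free_resolution I).

(* The resolution augmented by [S] in position 0, so that [I] and the
   modules [F_i] are treated alike. *)
Definition arank i := if i is i'.+1 then rk F i' else 1%N.

Definition adeg i : 'I_(arank i) -> nat :=
  match i with 0 => fun=> 0%N | i'.+1 => @deg _ _ _ F i' end.

Definition adiff i : 'M[S]_(arank i.+1, arank i) :=
  match i with 0 => aug F | i'.+1 => diff F i' end.

Lemma adiff_homog i : homog_mx (@adeg i.+1) (@adeg i) (adiff i).
Proof.
case: i => [|i] a b; last exact: (diff_homog a b).
by rewrite leq0n subn0 (ord1 b) /=; apply: aug_homog.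
Qed.

Lemma adiff_exact i (u : 'rV[S]_(arank i.+1)) :
  u *m adiff i = 0 <-> exists w : 'rV[S]_(arank i.+2), u = w *m adiff i.+1.
Proof. by case: i u => [|i] u; [apply: exact0 | apply: exactS]. Qed.

(** Exterior degree [t] with coefficients of degree [D]; the vectors [e_T] are not counted in [D],
    so [koszul] lowers [t] and raises [D]. *)
Definition homog_chain i (t D : nat) (y : chain (arank i)) :=
  forall T : {set 'I_n}, if #|T| == t then homog_row (@adeg i) D (y T) else y T = 0.

Lemma homog_koszul i t D y : @homog_chain i t.+1 D y ->
  homog_chain t D.+1 (koszul y).
Proof.
move=> hy T; case: eqP => cT.
  move=> a; rewrite koszulE contrE summxE.
  have term x : x \notin T -> if (adeg a <= D.+1)%N then
      (('X_x * (-1) ^+ rank_in T x) *: y (x |: T)) 0 a \is (D.+1 - adeg a).-homog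
    else (('X_x * (-1) ^+ rank_in T x) *: y (x |: T)) 0 a == 0.
    move=> xT; have := hy (x |: T); rewrite cardsU1 xT cT eqxx => /(_ a).
    rewrite mxE; case: leqP => [le_aD|lt_Da].
      rewrite (leq_trans le_aD) // subSn // -[(_ - _).+1]add1n => h.
      rewrite -mulrA; apply: dhomogM; first by rewrite dhomogX /= mdeg1.
      by rewrite -signr_odd; case: (odd _); rewrite ?mulN1r ?mul1r ?dhomogN.
    move/eqP ->; rewrite mulr0; case: ifP => // _; exact: dhomog0.
  case: leqP => le_aD.
    by apply: rpred_sum => x xT; have := term x xT; rewrite le_aD.
  apply/eqP/big1 => x xT; apply/eqP; have := term x xT.
  by rewrite leqNgt le_aD.
rewrite koszulE contrE big1 // => x xT; have := hy (x |: T).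
by rewrite cardsU1 xT eqSS; case: eqP => // _ ->; rewrite scaler0.
Qed.

Lemma homog_chain_lift i t D (c : chain (arank i)) : homog_chain t D c ->
  (forall T, exists w, c T = w *m adiff i) ->
  exists2 y : chain (arank i.+1), homog_chain t D y & mulc (adiff i) y = c.
Proof.
move=> hc lift.
have: forall T : {set 'I_n}, exists w : 'rV[S]_(arank i.+1),
    (if #|T| == t then homog_row (@adeg i.+1) D w else w = 0) /\
    w *m adiff i = c T.
  move=> T; have := hc T; case: eqP => [cT|_ ->]; last first.
    by exists 0; rewrite mul0mx.
  have [w ->] := lift T => hw.
  by have [w' hw' <-] := homog_lift (@adiff_homog i) hw; exists w'.
case/fin_all_exists => f hf; exists [ffun T => f T] => [T|].
  by rewrite ffunE; case: (hf T).
by apply/ffunP => T; rewrite mulcE ffunE; case: (hf T).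
Qed.

(** One stair of the double complex of [koszul] and [adiff]: [next] decomposes a lift [y'] of
    [koszul y]; subtracting the resulting correction from [y] leaves a Koszul cycle, to which
    [koszul_exact] applies. With [next] as a hypothesis the step serves both the induction and its
    start at the augmentation. *)
Lemma zigzag_step i t D (y : chain (arank i)) : homog_chain t.+1 D y ->
  (forall T, exists w, koszul y T = w *m adiff i) ->
  (forall y' : chain (arank i.+1), homog_chain t D.+1 y' ->
     mulc (adiff i) y' = koszul y ->
     exists (w : chain (arank i.+2)) (u : chain (arank i.+1)),
       u set0 = 0 /\ y' = mulc (adiff i.+1) w + koszul u) ->
  exists (w : chain (arank i.+1)) (u : chain (arank i)),
    u set0 = 0 /\ y = mulc (adiff i) w + koszul u.
Proof.
move=> hy lift next.
have [y' hy' def_y] := homog_chain_lift (homog_koszul hy) lift.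
have [w [u [u0 def_y']]] := next y' hy' def_y.
have [||u' u'0 def_u'] := @koszul_exact n k _ (y - mulc (adiff i) u).
- rewrite koszulB koszul_mulc -def_y def_y' mulcD.
  have -> : mulc (adiff i) (mulc (adiff i.+1) w) = 0.
    apply/ffunP => T; rewrite chain0 !mulcE.
    by apply/adiff_exact; exists (w T).
  by rewrite add0r; apply: subrr.
(* At [set0] both [u] and [y] are zero, the latter because its exterior degree is positive. *)
- move=> a; rewrite chainB mulcE u0 mul0mx subr0.
  by have := hy set0; rewrite cards0 => ->; rewrite mxE mcoeff0.
exists u, u'; split=> //; rewrite -def_u'.
by rewrite [RHS]addrC subrK.
Qed.

(* [Tor_t(I)_(t+3) = 0] kills the last corner of the zigzag through the terms
   of bidegree [(t - i, i)]; it is then carried back to the first. *)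
Lemma zigzag t (hTor : Tor_vanishes F t (t + 3)) j i (y : chain (arank i.+1)) :
  (j + i)%N = t -> homog_chain j (i + 3) y ->
  (exists u : chain (arank i), mulc (adiff i) y = koszul u) ->
  exists (w : chain (arank i.+2)) (u : chain (arank i.+1)),
    u set0 = 0 /\ y = mulc (adiff i.+1) w + koszul u.
Proof.
elim: j i y => [|j IHj] i y; last first.
  rewrite addSn => def_t hy [u def_u]; apply: zigzag_step hy _ _.
    move=> T; apply/adiff_exact; rewrite -mulcE -koszul_mulc def_u koszulK.
    by rewrite chain0.
  move=> y' hy' def_y'; apply: IHj => //; first by rewrite addnS.
  by exists y.
rewrite add0n => def_i; rewrite -{t}def_i in hTor *; move=> hy [u def_u].
(* The corner in exterior degree 0 gives a class in [F_i \otimes k]: its constant terms,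
   concentrated in degree [i + 3] by homogeneity, and a cycle because Koszul boundaries have no
   constant terms. *)
pose v : 'rV[k]_(rk F i) := map_mx (mcoeff 0%MM) (y set0).
have v_deg : in_degree (i + 3) v.
  move=> a; rewrite mxE; have := hy set0; rewrite cards0 eqxx => /(_ a) /=.
  case: leqP => [le_aD hom|_ /eqP ->]; last by rewrite mcoeff0 eqxx.
  case: (eqVneq (i + 3 - deg a)%N 0%N) => [eD _|neD]; first by lia.
  by rewrite (dhomog_nemf_coeff hom) ?eqxx //= mdeg0 eq_sym.
have v_cyc : is_cycle v.
  rewrite /v; case: i y u def_u {hTor hy v v_deg} => [//|i] y u def_u /=.
  rewrite -map_mxM; have := congr1 (fun c : chain (rk F i) => c set0) def_u.
  rewrite /= mulcE /= => ->; apply/rowP => a.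
  by rewrite !mxE koszul_const.
have [w def_v] := hTor v v_deg v_cyc.
(* Subtracting the image of this constant chain removes the constant terms of [y], so that the rest
   is a Koszul boundary. *)
pose wc : chain (arank i.+2) :=
  [ffun T : {set 'I_n} => if T == set0 then map_mx (@mpolyC n k) w else 0].
have wcE T : wc T = if T == set0 then map_mx (@mpolyC n k) w else 0.
  by rewrite ffunE.
have [||u' u'0 def_u'] := @koszul_exact n k _ (y - mulc (adiff i.+1) wc).
- apply/ffunP => T; rewrite koszulE contrE chain0; apply: big1 => x xT.
  have T0 : (x |: T == set0) = false by apply/set0Pn; exists x; rewrite setU11.
  rewrite chainB mulcE wcE T0 mul0mx subr0.
  by have := hy (x |: T); rewrite cards_eq0 T0 => ->; rewrite scaler0.
- move=> a; rewrite chainB mulcE wcE eqxx.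
  have := congr1 (fun M : 'rV_(rk F i) => M 0 a) def_v.
  rewrite !mxE => e; rewrite mcoeffB e raddf_sum; apply/eqP.
  rewrite subr_eq0; apply/eqP/eq_bigr => b _.
  rewrite !mxE; exact/esym/mcoeffCM.
exists wc, u'; split=> //; rewrite -def_u'.
by rewrite [RHS]addrC subrK.
Qed.

(** Over [S / I] the chain [z] is a Koszul cycle of exterior degree [t + 1] with quadratic
    coefficients. Its class lies in [Tor_{t+1}(S/I)], that is [Tor_t(I)], in degree [t + 3]; the
    zigzag makes this identification explicit. *)
Lemma Tor_obstruction t (z : chain 1) : Tor_vanishes F t (t + 3) ->
  @homog_chain 0 t.+1 2 z -> (forall T, I (koszul z T 0 0)) ->
  exists c u : chain 1, (forall T, I (c T 0 0)) /\ z = c + koszul u.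
Proof.
move=> hTor hz Iz; have [|y' hy' def_y'|w [u [_ def_z]]] := @zigzag_step 0 t 2 z hz.
- move=> T; have /(aug_onto F) [w def_w] := Iz T; exists w.
  by apply/rowP => a; rewrite ord1.
- by apply: (zigzag hTor (addn0 t)) => //; exists z.
exists (mulc (adiff 0) w), u; split=> // T.
by apply/(aug_onto F); exists (w T); rewrite mulcE.
Qed.

End ZigZag.

(** * The toric obstruction *)

Lemma base_digits_inj (K M : nat) (f g : 'I_M -> nat) :
  (forall v, f v < K)%N -> (forall v, g v < K)%N ->
  (\sum_v f v * K ^ v = \sum_v g v * K ^ v)%N -> f =1 g.
Proof.
elim: M f g => [|M IHM] f g fK gK; first by move=> _ [].
have shift (h : 'I_M.+1 -> nat) : (\sum_v h v * K ^ v =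
    (\sum_(v < M) h (lift ord0 v) * K ^ v) * K + h ord0)%N.
  rewrite big_ord_recl expn0 muln1 addnC big_distrl; congr (_ + _)%N.
  by apply: eq_bigr => v _; rewrite lift0 expnSr mulnA.
rewrite !shift => e.
have K0 : (0 < K)%N by apply: leq_ltn_trans (fK ord0).
have e0 : f ord0 = g ord0.
  by have := congr1 (modn^~ K) e; rewrite !modnMDl !modn_small.
move: e; rewrite -e0 => /addIn /eqP; rewrite eqn_pmul2r // => /eqP e v.
have [w ->|-> //] := unliftP ord0 v.
exact: (IHM (f \o lift ord0) (g \o lift ord0) (fun=> fK _) (fun=> gK _) e).
Qed.

(* Kronecker substitution [y_v := t^(K^v)] reduces to one variable. *)
Lemma mpoly_torus_eq0 (k : closedFieldType) (M : nat) (p : {mpoly k[M]}) :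
  (forall y : 'I_M -> k, (forall v, y v != 0) -> p.@[y] = 0) -> p = 0.
Proof.
move=> p0; pose K := msize p; pose code (m : 'X_{1..M}) := (\sum_v m v * K ^ v)%N.
pose q : {poly k} := \sum_(m <- msupp p) p@_m *: 'X^(code m).
have q_eval t : q.[t] = p.@[fun v => t ^+ (K ^ v)].
  rewrite horner_sum mevalE; apply: eq_bigr => m _.
  rewrite hornerZ hornerXn -prodrXr; congr (_ * _); apply: eq_bigr => v _.
  by rewrite -exprM mulnC.
have q0 : q = 0.
  (* The factor ['X] excludes the value 0, where the substitution leaves the torus; a nonzero
     polynomial over a closed field has a non-root. *)
  suff /eqP : 'X * q = 0 by rewrite mulf_eq0 polyX_eq0 => /eqP.
  apply/eqP; apply: contraT => /closed_nonrootP [t].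
  rewrite rootE hornerM hornerX q_eval mulf_eq0.
  have [//|t0] := eqVneq t 0.
  rewrite p0 ?eqxx //= => v; exact: expf_neq0.
apply/mpolyP => m; rewrite mcoeff0; have [mp|] := boolP (m \in msupp p); last first.
  exact: memN_msupp_eq0.
(* [K] exceeds the total degree, hence every exponent, so [code] is injective on the support. *)
have small m' : m' \in msupp p -> forall v, (m' v < K)%N.
  move=> m'p v; apply: leq_ltn_trans (msize_mdeg_lt m'p).
  by rewrite mdegE (bigD1 v) //= leq_addr.
have := congr1 (fun r : {poly k} => r`_(code m)) q0; rewrite coef0 coef_sum.
rewrite (bigD1_seq m) ?msupp_uniq //= big_seq_cond big1 => [|m' /andP[m'p ne]].
  by rewrite addr0 coefZ coefXn eqxx mulr1.
rewrite coefZ coefXn; case: eqP => [e|_]; last by rewrite mulr0.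
case/eqP: ne; apply/mnmP.
by apply: (@base_digits_inj K) (esym e) => v; exact: small.
Qed.

Section Toric.
Variables (k : fieldType) (n M : nat) (wt : 'I_n -> 'X_{1..M}).
Local Notation S := {mpoly k[n]}.

Definition toric_map (f : S) : {mpoly k[M]} := f \mPo [tuple 'X_[wt i] | i < n].

Lemma toric_map_is_additive : additive toric_map.
Proof. exact: raddfB. Qed.
HB.instance Definition _ :=
  GRing.isAdditive.Build S {mpoly k[M]} toric_map toric_map_is_additive.

Lemma toric_mapM f g : toric_map (f * g) = toric_map f * toric_map g.
Proof. exact: rmorphM. Qed.

Lemma toric_mapX x : toric_map 'X_x = 'X_[wt x].
Proof. by rewrite /toric_map comp_mpolyXU -tnth_nth tnth_mktuple. Qed.

Definition toric_coef (w : 'X_{1..M}) (f : S) : k := (toric_map f)@_w.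

Lemma toric_coef_is_additive w : additive (toric_coef w).
Proof. by move=> f g; rewrite /toric_coef raddfB mcoeffB. Qed.
HB.instance Definition _ w :=
  GRing.isAdditive.Build S k (toric_coef w) (toric_coef_is_additive w).

Lemma toric_coefXM w x f : toric_coef (wt x + w)%MM ('X_x * f) = toric_coef w f.
Proof. by rewrite /toric_coef toric_mapM toric_mapX mulrC mcoeffMX. Qed.

Lemma toric_coefXM0 w x f : ~~ (wt x <= w)%MM -> toric_coef w ('X_x * f) = 0.
Proof.
move=> nle; rewrite /toric_coef toric_mapM toric_mapX mulrC; apply: memN_msupp_eq0.
rewrite (perm_mem (msuppMX _ _)); apply: contra nle => /mapP[m _ ->].
by rewrite lem_addr.
Qed.

End Toric.

Section ToricObstruction.
Variables (k : fieldType) (n M : nat) (wt : 'I_n -> 'X_{1..M}).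
Variable X : ('I_n -> k) -> Prop.
Local Notation S := {mpoly k[n]}.

Hypothesis X_quadrics : forall v, X v -> forall x y x' y',
  (wt x + wt y = wt x' + wt y')%MM -> v x * v y = v x' * v y'.
Hypothesis X_ideal : forall f, homogeneous_ideal X f -> toric_map wt f = 0.

Variables (F1 F2 : {set 'I_n}) (a b : 'I_n -> 'I_n).

Let var (x : 'I_n) : S := 'X_x.
Let cycle := shift_cycle var F1 F2 a b.

Lemma contr_homog d l (c : chain n 'rV[S]_1) :
  (forall x, l x \is 1.-homog) -> (forall T, c T 0 0 \is d.-homog) ->
  forall T, contr l c T 0 0 \is d.+1.-homog.
Proof.
move=> hl hc T; rewrite contrE summxE; apply: rpred_sum => x _; rewrite mxE.
rewrite -mulrA -[d.+1]add1n; apply: dhomogM => //.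
by rewrite -signr_odd; case: (odd _); rewrite ?mulN1r ?mul1r ?dhomogN.
Qed.

Lemma shift_cycle_homog (I : S -> Prop) (F : graded_free_resolution I) t :
  (#|F1 :|: F2| = t.+3)%N -> @homog_chain k n I F 0 t.+1 2 cycle.
Proof.
have covector_homog (C : {set 'I_n}) h x : shift_covector var C h x \is 1.-homog.
  rewrite /shift_covector; case: ifP => _; last exact: dhomog0.
  by rewrite dhomogX /= mdeg1.
move=> cF T; case: eqP => [_ i|ne].
  rewrite (ord1 i) /= subn0; apply: contr_homog => [x|A].
    exact: covector_homog.
  apply: contr_homog => [x|A']; first exact: covector_homog.
  rewrite singleE; case: ifP => _; rewrite mxE ?dhomog0 //; exact: dhomog1.
by apply: contr2_supp; rewrite cF !eqSS; apply/negP => /andP[_ /eqP].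
Qed.

Variables (e : nat -> 'I_n) (L : nat) (B : {set 'I_n}) (c' : 'I_n).
Hypothesis disF : [disjoint F1 & F2].
Hypothesis wt_a : {in F1 &, forall x y, wt x + wt (a y) = wt y + wt (a x)}%MM.
Hypothesis wt_b : {in F2 &, forall x y, wt x + wt (b y) = wt y + wt (b x)}%MM.
Hypothesis L_ge3 : (3 <= L)%N.
Hypothesis eL : e L = e 0%N.
Hypothesis eB : forall s, (s < L)%N -> e s \in B.
Hypothesis e_simple : forall s, (0 < s < L)%N -> e s != e 0%N.
Hypothesis e_closed : forall s w, (s < L)%N ->
  (wt w <= wt (e s) + wt (e s.+1))%MM -> w \in B.
Hypothesis F12 : F1 :|: F2 = c' |: B :\ e 0%N.
Hypothesis c'B : c' \notin B.
Hypothesis c'F2 : c' \in F2.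
Hypothesis e1F1 : e 1%N \in F1.
Hypothesis eL1F2 : e L.-1 \in F2.
Hypothesis wt_corner : (wt (a (e 1%N)) + wt (b c') = wt (e 0%N) + wt (e 1%N))%MM.

Lemma toric_not_N2 q : (#|B| <= q + 2)%N -> ~ property_N2 q (homogeneous_ideal X).
Proof.
move=> Bq [F vanF].
have [L_gt0 L_gt1 [Lp_gt0 LpL]] :
    [/\ (0 < L)%N, (1 < L)%N & (0 < L.-1)%N /\ (L.-1 < L)%N].
  by clear -L_ge3; case: L L_ge3 => [|[]].
have e0B : e 0%N \in B by exact: eB.
have cF : #|F1 :|: F2| = #|B|.
  by rewrite F12 cardsU1 !inE (negbTE c'B) andbF [in RHS](cardsD1 (e 0%N)) e0B.
(* [e 0], [e 1] and [e L.-1] are distinct, the last two lying in the disjoint sets [F1] and [F2];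
   thus [#|B| - 3] below is not truncated. *)
have B_ge3 : (3 <= #|B|)%N.
  have e1 : e 1%N != e 0%N by apply: e_simple; rewrite ?Lp_gt0.
  have eL1 : e L.-1 != e 0%N by apply: e_simple; rewrite ?Lp_gt0.
  have e1L : e L.-1 != e 1%N by apply: contraTneq eL1F2 => ->; rewrite (disjointFr disF).
  rewrite (cardsD1 (e 0%N)) (cardsD1 (e 1%N)) (cardsD1 (e L.-1)) e0B !inE e1 eL1 e1L.
  by rewrite !eB.
(* Contracting a product of [#|B|] basis vectors twice leaves exterior degree [t.+1], which concerns
   [Tor_t] in degree [t + 3]. *)
pose t := (#|B| - 3)%N; have def_t : #|F1 :|: F2| = t.+3 by rewrite cF /t -addn3 subnK.
have Tor0 : Tor_vanishes F t (t + 3).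
  by apply: vanF; rewrite /t ?ltn_add2l //; clear -B_ge3 Bq; lia.
have [T v Xv|c [u [Ic def_z]]] := Tor_obstruction Tor0 (shift_cycle_homog F def_t).
  rewrite koszulE; apply: (contr_shift_cycle disF (f := meval v)) => x y xF yF;
    rewrite /var /= !mevalXU; apply: X_quadrics => //; [exact: wt_a | exact: wt_b].
pose coef1 x : {additive S -> k} := toric_coef wt (wt x).
pose coef2 x y : {additive S -> k} := toric_coef wt (wt x + wt y)%MM.
have coef2l x y f : coef2 x y (var x * f) = coef1 y f by exact: toric_coefXM.
have coef2r x y f : coef2 x y (var y * f) = coef1 x f.
  by rewrite /coef2 addmC; exact: toric_coefXM.
have corner : coef2 (e 0%N) (e 1%N) (var (a (e 1%N)) * var (b c')) = 1.
  rewrite /coef2 /= -wt_corner toric_coefXM /toric_coef toric_mapX.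
  by rewrite mcoeffX eqxx.
have [i] := cyclic_form_shift_cycle disF L_ge3 eL eB e_simple F12 c'B c'F2 e1F1
  eL1F2 corner.
rewrite -/cycle def_z cyclic_formD cyclic_form0; last first.
  by move=> x y T; rewrite /coef2 /= /toric_coef X_ideal ?mcoeff0.
rewrite koszulE (cyclic_form_contr coef2l coef2r) ?addr0 //; last first.
  move=> s w f sL wB; apply: toric_coefXM0; apply: contra wB; exact: e_closed.
by move/esym/eqP; rewrite signr_eq0.
Qed.

End ToricObstruction.

(** * Lattice cycles in Segre-Veronese varieties *)

Section SegreVeroneseToric.
Variables (k : closedFieldType) (m : nat) (n d : 'I_m -> nat).
Local Notation N := #|multi_exponents n d|.

Let coord := {i : 'I_m & 'I_(n i).+1}.

Definition expo (l : 'I_N) (i : 'I_m) (j : 'I_(n i).+1) : nat := tnth (enum_val l i) j.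

Definition sv_weight (l : 'I_N) : 'X_{1..#|{: coord}|} :=
  [multinom expo l (tagged (enum_val v)) | v < #|{: coord}|].

Lemma expo_sum l i : (\sum_j @expo l i j)%N = d i.
Proof.
have := enum_valP l; rewrite inE => /forallP/(_ i)/eqP <-.
by rewrite big_tuple.
Qed.

Lemma expo_inj (l l' : 'I_N) : (forall i j, @expo l i j = @expo l' i j) -> l = l'.
Proof.
move=> e; apply: enum_val_inj; apply/ffunP => i; apply: eq_from_tnth => j.
exact/val_inj/e.
Qed.

Lemma sv_weight_le (w x y : 'I_N) : (sv_weight w <= sv_weight x + sv_weight y)%MM ->
  forall i j, (@expo w i j <= @expo x i j + @expo y i j)%N.
Proof.
move=> /mnm_lepP le i j; have := le (enum_rank (Tagged (fun i => 'I_(n i).+1) j)).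
by rewrite mnmDE !mnmE enum_rankK.
Qed.

Lemma sv_weightD_eq (x y x' y' : 'I_N) :
  (forall i j, @expo x i j + @expo y i j = @expo x' i j + @expo y' i j)%N <->
  (sv_weight x + sv_weight y = sv_weight x' + sv_weight y')%MM.
Proof.
split=> [e|/mnmP e i j].
  by apply/mnmP => v; rewrite !mnmDE !mnmE e.
have := e (enum_rank (Tagged (fun i => 'I_(n i).+1) j)).
by rewrite !mnmDE !mnmE enum_rankK.
Qed.

Lemma sv_quadrics (v : 'I_N -> k) : segre_veronese k n d v -> forall x y x' y' : 'I_N,
  (sv_weight x + sv_weight y = sv_weight x' + sv_weight y')%MM ->
  v x * v y = v x' * v y'.
Proof.
move=> [z [c [_ _ def_v]]] x y x' y' /sv_weightD_eq e.
rewrite !def_v mulrACA [RHS]mulrACA; congr (_ * _); rewrite /segre_veronese_map -!big_split.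
apply: eq_bigr => i _ /=; rewrite -!big_split; apply: eq_bigr => j _ /=.
by rewrite -!exprD; congr (_ ^+ _); apply: e.
Qed.

(** The pullback of [f] vanishes at all points with nonzero coordinates, since their images lie on
    the variety. *)
Lemma sv_ideal (f : {mpoly k[N]}) :
  homogeneous_ideal (segre_veronese k n d) f -> toric_map sv_weight f = 0.
Proof.
move=> If; apply: mpoly_torus_eq0 => y y0; rewrite /toric_map comp_mpoly_meval.
apply: If; exists (fun i => \row_j y (enum_rank (Tagged (fun i => 'I_(n i).+1) j))), 1.
split=> [i||l]; first 1 last.
- exact: oner_neq0.
- rewrite tnth_mktuple mevalX mul1r /segre_veronese_map.
  rewrite sig_big_dep /= (reindex (@enum_val _ [eta predT : pred coord])) /=; last first.
    exact/onW_bij/enum_val_bij.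
  apply: eq_bigr => v _; rewrite !mnmE mxE; congr (y _ ^+ _).
  by rewrite -[LHS]enum_valK; congr enum_rank; case: (enum_val v).
apply/eqP => /rowP/(_ ord0)/eqP; rewrite !mxE; apply/negP; exact: y0.
Qed.

Section LatticePoints.
Hypothesis n_ge1 : forall i, (1 <= n i)%N.

(* The exponent of [\prod_i y_i0^(d_i - g_i) y_i1^(g_i)], with [g_i] cut off at
   [d_i] to make the definition total. *)
Definition point_block (g : 'I_m -> nat) i (j : nat) : nat :=
  (if j == 0 then d i - g i else if j == 1 then minn (g i) (d i) else 0)%N.

Definition point_exp (g : 'I_m -> nat) : {dffun forall i, (n i).+1.-tuple 'I_(d i).+1} :=
  [ffun i : 'I_m => [tuple inord (point_block g i j) | j < (n i).+1]
     : (n i).+1.-tuple 'I_(d i).+1].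

Lemma point_expE g i j : tnth (point_exp g i) j = point_block g i j :> nat.
Proof.
rewrite ffunE tnth_mktuple inordK // ltnS /point_block.
by case: ifP => _; [rewrite leq_subr | case: ifP => _; rewrite ?geq_minr].
Qed.

Lemma sum_first2 i (h : nat -> nat) : (forall j, (1 < j)%N -> h j = 0%N) ->
  (\sum_(j < (n i).+1) h j = h 0 + h 1)%N.
Proof.
move=> h0; case: (n i) (n_ge1 i) => // n' _; rewrite big_ord_recl big_ord_recl.
by rewrite big1 ?addn0 // => j _; apply: h0.
Qed.

Lemma point_exp_in g : point_exp g \in multi_exponents n d.
Proof.
rewrite inE; apply/forallP => i; rewrite big_tuple.
rewrite (eq_bigr (fun j : 'I_(n i).+1 => point_block g i j)) => [|j _]; last exact: point_expE.
rewrite sum_first2 => [|j j2]; rewrite /point_block /=; last by case: j j2 => [|[]].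
by apply/eqP; lia.
Qed.

Definition point (g : 'I_m -> nat) : 'I_N := enum_rank_in (point_exp_in g) (point_exp g).

Lemma expo_point g i j : (forall i, g i <= d i)%N -> @expo (point g) i j =
  (if j == 0 :> nat then d i - g i else if j == 1 :> nat then g i else 0)%N.
Proof.
move=> gd; rewrite /expo enum_rankK_in ?point_exp_in // point_expE /point_block.
by rewrite (minn_idPl (gd i)).
Qed.

Let j1 i : 'I_(n i).+1 := inord 1.

(** Serves to recognise the divisors of a product of two points, which involve only the first two
    variables of each group. *)
Lemma point_expo (w : 'I_N) : (forall i (j : 'I_(n i).+1), (1 < j)%N -> @expo w i j = 0%N) ->
  (forall i, @expo w i (j1 i) <= d i)%N /\ w = point (fun i => @expo w i (j1 i)).
Proof.
move=> w0.
have sum_w i : (@expo w i ord0 + @expo w i (j1 i))%N = d i.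
  rewrite -(expo_sum w i) (bigD1 ord0) //= (bigD1 (j1 i)) /=; last first.
    by rewrite -val_eqE /= inordK // ltnS.
  rewrite big1 ?addn0 // => j /andP[j0 jj]; apply: w0.
  move: j0 jj; rewrite -!val_eqE /= inordK ?ltnS //.
  by case: (nat_of_ord j) => [|[]].
have le i : (@expo w i (j1 i) <= d i)%N by rewrite -sum_w leq_addl.
split=> //; apply: expo_inj => i j; rewrite expo_point //.
have [j_0|j_0] := eqVneq (nat_of_ord j) 0%N.
  by rewrite -(sum_w i) addnK (_ : j = ord0) //; apply: val_inj.
have [j_1|j_1] := eqVneq (nat_of_ord j) 1%N.
  by congr expo; apply: val_inj; rewrite /= inordK // ltnS.
by apply: w0; case: (nat_of_ord j) j_0 j_1 => [|[]].
Qed.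

Lemma point_inj g h : (forall i, g i <= d i)%N -> (forall i, h i <= d i)%N ->
  point g = point h -> g =1 h.
Proof.
move=> gd hd e i; have := congr1 (fun l => @expo l i (j1 i)) e.
by rewrite /= !expo_point // inordK // ltnS.
Qed.

Lemma eq_point g h : g =1 h -> point g = point h.
Proof.
move=> gh; apply: enum_val_inj; rewrite !enum_rankK_in ?point_exp_in //.
apply/ffunP => i; apply: eq_from_tnth => j; apply: val_inj.
by rewrite /= !point_expE /point_block gh.
Qed.

Definition level (x : 'I_N) i := @expo x i (j1 i).

Lemma level_point g i : (forall i, g i <= d i)%N -> level (point g) i = g i.
Proof. by move=> gd; rewrite /level expo_point // inordK // ltnS. Qed.

(** Translation by minus a unit vector; despite truncated subtraction it is a true translation on
    points of positive level in [i0]. *)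
Definition lower (i0 : 'I_m) (x : 'I_N) := point (fun i => level x i - (i == i0))%N.

Lemma lower_weight i0 g h : (forall i, g i <= d i)%N -> (forall i, h i <= d i)%N ->
  (0 < g i0)%N -> (0 < h i0)%N ->
  (sv_weight (point g) + sv_weight (lower i0 (point h)) =
   sv_weight (point h) + sv_weight (lower i0 (point g)))%MM.
Proof.
move=> gd hd g0 h0; apply/sv_weightD_eq => i j; rewrite !expo_point //.
- rewrite !level_point //; have := gd i; have := hd i.
  have : ((i == i0) <= g i)%N by case: eqVneq => [->|].
  have : ((i == i0) <= h i)%N by case: eqVneq => [->|].
  move: (i == i0 : nat) (g i) (h i) (d i) => b0 gi hi di.
  by case: ifP => _; last case: ifP => _; lia.
- by move=> l; rewrite level_point //; apply: leq_trans (leq_subr _ _) (gd l).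
- by move=> l; rewrite level_point //; apply: leq_trans (leq_subr _ _) (hd l).
Qed.

Section LatticeCycle.
(** The path leaves the origin along [r] and comes back from a point of positive level in [p]. By
    [e_pos] its other points can be translated by minus [r] or minus [p]; [e_corner] keeps the sum
    of the unit vectors of [p] and [r] off the path. *)
Variables (e : nat -> 'I_m -> nat) (L : nat) (p r : 'I_m).
Hypothesis d_ge1 : forall i, (1 <= d i)%N.
Hypothesis p_r : p != r.
Hypothesis L_ge3 : (3 <= L)%N.
Hypothesis e_le : forall s i, (e s i <= d i)%N.
Hypothesis e0 : forall i, e 0 i = 0%N.
Hypothesis eL : forall i, e L i = 0%N.
Hypothesis e1 : forall i, e 1 i = (i == r).
Hypothesis eL1 : (0 < e L.-1 p)%N.
Hypothesis e_pos : forall s, (0 < s < L)%N -> e s p = 0%N -> (0 < e s r)%N.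
Hypothesis e_corner : forall s, (s < L)%N -> (e s p != 1%N) || (e s r != 1%N) ||
  [exists i, (i != p) && (i != r) && (e s i != 0%N)].
(* The hypotheses on [u] say that the point [u] divides the product of the
   monomials at [e s] and [e s.+1]. *)
Hypothesis e_edge : forall s u, (s < L)%N ->
  (forall i, u i <= e s i + e s.+1 i /\ d i - u i <= (d i - e s i) + (d i - e s.+1 i))%N ->
  (forall i, u i <= d i)%N -> exists2 s', (s' < L)%N & e s' =1 u.

Let E s := point (e s).
Let B := [set E s | s : 'I_L].
Let corner i : nat := (i == p) + (i == r).
Let c' := point corner.
Let U := c' |: B :\ E 0.
(** Points of [F1] have positive level in [r] by [e_pos], so [lower r] translates [F1] and [lower p]
    translates [F2]; the corner falls in [F2]. *)
Let F1 := [set x in U | level x p == 0%N].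
Let F2 := [set x in U | level x p != 0%N].

Let corner_le i : (corner i <= d i)%N.
Proof.
have := d_ge1 i; rewrite /corner; case: (eqVneq i p) => [->|_] /=; last by case: (i == r).
by rewrite (negbTE p_r).
Qed.

Let U_points x : x \in U -> exists2 g, (forall i, g i <= d i)%N &
  x = point g /\ (g p = 0%N -> (0 < g r)%N).
Proof.
rewrite !inE => /orP[/eqP ->|/andP[x0 /imsetP[s _ def_x]]].
  by exists corner => //; split=> //; rewrite /corner eqxx.
exists (e s); first exact: e_le.
split=> // sp; apply: e_pos sp; rewrite ltn_ord andbT lt0n.
by apply: contraNneq x0 => s0; rewrite def_x s0.
Qed.

Lemma lattice_cycle_not_N2 q : (L <= q + 2)%N ->
  ~ property_N2 q (homogeneous_ideal (segre_veronese k n d)).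
Proof.
move=> Lq.
have EB s : (s < L)%N -> E s \in B by move=> sL; apply/imsetP; exists (Ordinal sL).
have e_neq0 s : (0 < s < L)%N -> E s != E 0.
  move=> sL; apply: contraTneq (sL) => /(point_inj (e_le s) (e_le 0)) es0.
  by have := e_pos sL; rewrite !es0 !e0 ltnn => /(_ erefl).
have c'B : c' \notin B.
  apply/negP => /imsetP[s _ /(point_inj corner_le (e_le s)) cs].
  have := e_corner (ltn_ord s); rewrite -!cs /corner !eqxx (eq_sym r) (negbTE p_r) /=.
  case/existsP => i; rewrite -cs /corner.
  by case: (i == p); case: (i == r).
have Lp : (0 < L.-1 < L)%N by clear -L_ge3; case: L L_ge3 => [|[]] //= ?; rewrite ltnSn.
have inU s : (0 < s < L)%N -> E s \in U.
  by move=> sL; rewrite !inE e_neq0 // EB ?orbT //; case/andP: sL.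
have L_gt1 : (0 < 1 < L)%N by rewrite (leq_trans _ L_ge3).
apply: (@toric_not_N2 k _ _ sv_weight _ sv_quadrics sv_ideal
  F1 F2 (lower r) (lower p) E L B c' _ _ _ L_ge3).
- rewrite -setI_eq0; apply/eqP/setP => x; rewrite !inE.
  by case: (level x p == 0%N); rewrite ?andbF.
- move=> x y; rewrite inE => /andP[/U_points[g gd [-> g_pos]]].
  rewrite (level_point _ gd) => /eqP/g_pos gr.
  rewrite inE => /andP[/U_points[h hd [-> h_pos]]].
  rewrite (level_point _ hd) => /eqP/h_pos hr; exact: lower_weight gd hd gr hr.
- move=> x y; rewrite inE => /andP[/U_points[g gd [-> _]]].
  rewrite (level_point _ gd) -lt0n => gp.
  rewrite inE => /andP[/U_points[h hd [-> _]]].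
  rewrite (level_point _ hd) -lt0n => hp; exact: lower_weight gd hd gp hp.
- by apply: eq_point => i; rewrite eL e0.
- exact: EB.
- exact: e_neq0.
- move=> s w sL /sv_weight_le le.
  have [|lev_le def_w] := @point_expo w.
    move=> i j j_gt1; apply/eqP; rewrite -leqn0; apply: leq_trans (le i j) _.
    by rewrite !expo_point //; case: (nat_of_ord j) j_gt1 => [|[]].
  have [i|//|s' s'L def_u] := e_edge (u := level w) sL.
    (* The exponents of the two variables of a group give the two inequalities of [e_edge]. *)
    have := le i ord0; have := le i (j1 i); rewrite def_w !expo_point //.
    by rewrite inordK ?ltnS // level_point.
  by rewrite def_w -(eq_point def_u); apply: EB.
- by apply/setP => x; rewrite in_setU [x \in F1]inE [x \in F2]inE -andb_orr orbN andbT.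
- exact: c'B.
- by rewrite !inE eqxx /= level_point // /corner eqxx.
- by rewrite inE inU // level_point // e1 (negbTE p_r).
- by rewrite inE inU // level_point // -lt0n.
- have -> : lower r (E 1) = E 0.
    apply: eq_point => l; rewrite (level_point _ (e_le 1)) e1 e0.
    by case: (l == r).
  suff -> : lower p c' = E 1 by [].
  apply: eq_point => l; rewrite (level_point _ corner_le) e1 /corner.
  by case: (eqVneq l p) => [->|]; rewrite ?(negbTE p_r) //= subn0.
- apply: leq_trans Lq; rewrite -[X in (_ <= X)%N](card_ord L); exact: leq_imset_card.
Qed.

End LatticeCycle.
End LatticePoints.

End SegreVeroneseToric.

(* The boundary of a rectangle and the hexagon in a box *)
Local Close Scope ring_scope.

(* The coordinates of both lattice cycles, as functions of the position [s] on
   the path, rise from 0 to their maximum, rest there and descend to 0. *)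
Definition trapezoid (start stop height s : nat) := minn (minn (s - start) height) (stop - s).

Lemma trapezoid_low start stop h s : s <= start -> trapezoid start stop h s = 0.
Proof. by rewrite /trapezoid; lia. Qed.

Lemma trapezoid_high start stop h s : stop <= s -> trapezoid start stop h s = 0.
Proof. by rewrite /trapezoid; lia. Qed.

Lemma trapezoid_up start stop h s : s - start <= h -> s - start <= stop - s ->
  trapezoid start stop h s = s - start.
Proof. by rewrite /trapezoid; lia. Qed.

Lemma trapezoid_top start stop h s : start + h <= s -> s + h <= stop ->
  trapezoid start stop h s = h.
Proof. by rewrite /trapezoid; lia. Qed.

Lemma trapezoid_down start stop h s : stop - s <= h -> stop - s <= s - start ->
  trapezoid start stop h s = stop - s.
Proof. by rewrite /trapezoid; lia. Qed.

(** The sides are traversed with x rising, y rising, x falling, y falling. On each, the resting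
    coordinate is 0 or maximal, so the inequalities fix it, and the other coordinate determines the
    position. *)
Lemma square_edge a b s u v : 0 < a -> 0 < b -> s < 2 * (a + b) ->
  let x := trapezoid 0 (2 * a + b) a in let y := trapezoid a (2 * a + 2 * b) b in
  u <= a -> u <= x s + x s.+1 -> a - u <= (a - x s) + (a - x s.+1) ->
  v <= b -> v <= y s + y s.+1 -> b - v <= (b - y s) + (b - y s.+1) ->
  exists2 s', s' < 2 * (a + b) & x s' = u /\ y s' = v.
Proof.
move=> a0 b0 sL /=.
have [s_a|a_s] := ltnP s a.
  rewrite !(@trapezoid_low a); [|lia|lia] => ub u1 u2 vb v1 v2.
  exists u; first by lia.
  by rewrite trapezoid_up ?trapezoid_low; lia.
have [s_ab|ab_s] := ltnP s (a + b).
  rewrite !(@trapezoid_top 0); [|lia|lia|lia|lia] => ub u1 u2 vb v1 v2.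
  exists (a + v); first by lia.
  by rewrite trapezoid_top ?trapezoid_up; lia.
have [s_2ab|ab2_s] := ltnP s (2 * a + b).
  rewrite !(@trapezoid_top a); [|lia|lia|lia|lia] => ub u1 u2 vb v1 v2.
  exists (2 * a + b - u); first by lia.
  by rewrite trapezoid_down ?trapezoid_top; lia.
rewrite !(@trapezoid_high 0); [|lia|lia] => ub u1 u2 vb v1 v2.
(* The last side ends at the origin, whose position within the range is 0 and not [2 * (a + b)]. *)
have [v0|v_gt0] := posnP v.
  by exists 0; rewrite ?trapezoid_low; lia.
exists (2 * a + 2 * b - v); first by lia.
by rewrite trapezoid_high ?trapezoid_down; lia.
Qed.

(** The coordinates rise in the order z, y, x and fall in the same order, so the vertices (x, y, z)
    = (1, 0, c) and (0, 1, 0) are missed. On each edge the inequalities fix the two resting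
    coordinates. *)
Lemma hexagon_edge c s u v w : 0 < c -> s < 2 * c + 4 ->
  let z := trapezoid 0 (2 * c + 2) c in let y := trapezoid c (2 * c + 3) 1 in
  let x := trapezoid c.+1 (2 * c + 4) 1 in
  u <= 1 -> u <= x s + x s.+1 -> 1 - u <= (1 - x s) + (1 - x s.+1) ->
  v <= 1 -> v <= y s + y s.+1 -> 1 - v <= (1 - y s) + (1 - y s.+1) ->
  w <= c -> w <= z s + z s.+1 -> c - w <= (c - z s) + (c - z s.+1) ->
  exists2 s', s' < 2 * c + 4 & [/\ x s' = u, y s' = v & z s' = w].
Proof.
move=> c0 sL /=.
have [s1|s1] := ltnP s c.
  rewrite !(@trapezoid_low c.+1) ?(@trapezoid_low c); try by lia.
  move=> ub u1 u2 vb v1 v2 wb w1 w2; exists w; first by lia.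
  by rewrite (@trapezoid_low c.+1) ?(@trapezoid_low c) ?(@trapezoid_up 0); try split; lia.
have [s2|s2] := ltnP s c.+1.
  rewrite !(@trapezoid_low c.+1) ?(@trapezoid_top 0); try by lia.
  move=> ub u1 u2 vb v1 v2 wb w1 w2; exists (c + v); first by lia.
  by rewrite (@trapezoid_low c.+1) ?(@trapezoid_up c) ?(@trapezoid_top 0); try split; lia.
have [s3|s3] := ltnP s c.+2.
  rewrite !(@trapezoid_top c) ?(@trapezoid_top 0); try by lia.
  move=> ub u1 u2 vb v1 v2 wb w1 w2; exists (c.+1 + u); first by lia.
  by rewrite (@trapezoid_up c.+1) ?(@trapezoid_top c) ?(@trapezoid_top 0); try split; lia.
have [s4|s4] := ltnP s (2 * c + 2).
  rewrite !(@trapezoid_top c) ?(@trapezoid_top c.+1); try by lia.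
  move=> ub u1 u2 vb v1 v2 wb w1 w2; exists (2 * c + 2 - w); first by lia.
  by rewrite (@trapezoid_top c.+1) ?(@trapezoid_top c) ?(@trapezoid_down 0); try split; lia.
have [s5|s5] := ltnP s (2 * c + 3).
  rewrite !(@trapezoid_top c.+1) ?(@trapezoid_high 0); try by lia.
  move=> ub u1 u2 vb v1 v2 wb w1 w2; exists (2 * c + 3 - v); first by lia.
  by rewrite (@trapezoid_top c.+1) ?(@trapezoid_down c) ?(@trapezoid_high 0); try split; lia.
rewrite !(@trapezoid_high c) ?(@trapezoid_high 0); try by lia.
move=> ub u1 u2 vb v1 v2 wb w1 w2; have [u0|u_gt0] := posnP u.
  by exists 0; [lia | rewrite !trapezoid_low; try split; lia].
exists (2 * c + 3); first by lia.
by rewrite (@trapezoid_down c.+1) ?(@trapezoid_high c) ?(@trapezoid_high 0); try split; lia.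
Qed.

(** * The two paths for given degrees, and the three cases *)

Section Main.
Variables (k : closedFieldType) (m : nat) (n d : 'I_m -> nat).
Hypotheses (n_ge1 : forall i, 1 <= n i) (d_ge1 : forall i, 1 <= d i).

Lemma square_not_N2 i j q : i != j -> 1 < d i -> 1 < d j -> 2 * (d i + d j) <= q + 2 ->
  ~ property_N2 q (homogeneous_ideal (segre_veronese k n d)).
Proof.
move=> ij di dj.
pose x := trapezoid 0 (2 * d i + d j) (d i).
pose y := trapezoid (d i) (2 * d i + 2 * d j) (d j).
pose e s l := if l == i then x s else if l == j then y s else 0.
have ei s : e s i = x s by rewrite /e eqxx.
have ej s : e s j = y s by rewrite /e eq_sym (negbTE ij) eqxx.
have eother s l : l != i -> l != j -> e s l = 0.
  by rewrite /e => /negbTE -> /negbTE ->.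
have pointwise (P : 'I_m -> Prop) : P i -> P j -> (forall l, l != i -> l != j -> P l) ->
    forall l, P l.
  move=> Pi Pj Po l; have [->|li] := eqVneq l i => //.
  by have [->|lj] := eqVneq l j => //; apply: Po.
apply: (@lattice_cycle_not_N2 k m n d n_ge1 e _ j i) => //.
- by rewrite eq_sym.
- by lia.
- move=> s; apply: pointwise => [||l li lj]; rewrite ?ei ?ej ?eother // /x /y /trapezoid; lia.
- by apply: pointwise => [||l li lj]; rewrite ?ei ?ej ?eother // /x /y /trapezoid; lia.
- by apply: pointwise => [||l li lj]; rewrite ?ei ?ej ?eother // /x /y /trapezoid; lia.
- apply: pointwise => [||l li lj]; rewrite ?ei ?ej ?eother ?eqxx ?(negbTE li) //.
    by rewrite /x /trapezoid; lia.
  by rewrite eq_sym (negbTE ij) /y /trapezoid; lia.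
- by rewrite ej /y /trapezoid; lia.
- by move=> s; rewrite ei ej /x /y /trapezoid; lia.
(* Both sides have length at least 2, so (1, 1) is interior to the rectangle. *)
- by move=> s sL; rewrite ei ej /x /y /trapezoid; apply/orP; left; lia.
move=> s u sL bnd ud.
have := bnd i; have := bnd j; rewrite !ei !ej => -[v1 v2] [u1 u2].
have [s' s'L [xs ys]] := square_edge (ltnW di) (ltnW dj) sL (ud i) u1 u2 (ud j) v1 v2.
exists s' => //; apply: pointwise => [||l li lj]; rewrite ?ei ?ej ?eother //.
by have [] := bnd l; rewrite !eother // leqn0 => /eqP ->.
Qed.

Lemma hexagon_not_N2 i1 i2 i3 q : i1 != i2 -> i1 != i3 -> i2 != i3 ->
  d i1 = 1 -> d i2 = 1 -> 2 * d i3 + 4 <= q + 2 ->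
  ~ property_N2 q (homogeneous_ideal (segre_veronese k n d)).
Proof.
move=> i12 i13 i23 d1 d2; have c0 := d_ge1 i3.
pose z := trapezoid 0 (2 * d i3 + 2) (d i3).
pose y := trapezoid (d i3) (2 * d i3 + 3) 1.
pose x := trapezoid (d i3).+1 (2 * d i3 + 4) 1.
pose e s l := if l == i1 then x s else if l == i2 then y s else if l == i3 then z s else 0.
have e1 s : e s i1 = x s by rewrite /e eqxx.
have e2 s : e s i2 = y s by rewrite /e eq_sym (negbTE i12) eqxx.
have e3 s : e s i3 = z s by rewrite /e !(eq_sym i3) (negbTE i13) (negbTE i23) eqxx.
have eother s l : l != i1 -> l != i2 -> l != i3 -> e s l = 0.
  by rewrite /e => /negbTE -> /negbTE -> /negbTE ->.
have pointwise (P : 'I_m -> Prop) : P i1 -> P i2 -> P i3 ->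
    (forall l, l != i1 -> l != i2 -> l != i3 -> P l) -> forall l, P l.
  move=> P1 P2 P3 Po l; have [->|l1] := eqVneq l i1 => //.
  have [->|l2] := eqVneq l i2 => //.
  by have [->|l3] := eqVneq l i3 => //; apply: Po.
apply: (@lattice_cycle_not_N2 k m n d n_ge1 e _ i1 i3) => //.
- by lia.
- move=> s; apply: pointwise => [|||l l1 l2 l3];
    rewrite ?e1 ?e2 ?e3 ?eother // /x /y /z /trapezoid; lia.
- by apply: pointwise => [|||l l1 l2 l3];
    rewrite ?e1 ?e2 ?e3 ?eother // /x /y /z /trapezoid; lia.
- by apply: pointwise => [|||l l1 l2 l3];
    rewrite ?e1 ?e2 ?e3 ?eother // /x /y /z /trapezoid; lia.
- apply: pointwise => [|||l l1 l2 l3];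
    rewrite ?e1 ?e2 ?e3 ?eother ?eqxx ?(negbTE i13) ?(negbTE i23) ?(negbTE l3) //;
    rewrite /x /y /z /trapezoid; lia.
- by rewrite e1 /x /trapezoid; lia.
- by move=> s; rewrite e1 e3 /x /z /trapezoid; lia.
(* The corner is (1, 0, 1) in the coordinates x, y, z; wherever y is 0 on the path, x or z is 0 as
   well. *)
- move=> s sL; have [ys|ys] := eqVneq (y s) 0; last first.
    by rewrite orbC; apply/orP; left; apply/existsP; exists i2; rewrite e2 ys eq_sym i12 i23.
  by rewrite e1 e3; move: ys; rewrite /x /y /z /trapezoid => ys; apply/orP; left; lia.
move=> s u sL bnd ud.
have := bnd i1; have := bnd i2; have := bnd i3; rewrite !e1 !e2 !e3.
have := ud i1; have := ud i2; rewrite d1 d2 => v0 u0 [w1 w2] [v1 v2] [u1 u2].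
have [s' s'L [xs ys zs]] := hexagon_edge c0 sL u0 u1 u2 v0 v1 v2 (ud i3) w1 w2.
exists s' => //; apply: pointwise => [|||l l1 l2 l3]; rewrite ?e1 ?e2 ?e3 ?eother //.
by have [] := bnd l; rewrite !eother // leqn0 => /eqP ->.
Qed.

End Main.

Theorem proposition3p6 (k : closedFieldType) (m : nat) (n d : 'I_m -> nat)
    (n_ge1 : forall i, 1 <= n i) (d_ge1 : forall i, 1 <= d i) :
  [/\ 3 <= m -> 3 <= #|[pred i | d i == 1]| ->
        ~ property_N 4 (segre_veronese k n d),
      3 <= m -> #|[pred i | d i == 1]| = 2 ->
        ~ property_N (2 * min_over [pred i | 1 < d i] d + 2)
            (segre_veronese k n d) &
      (3 <= m /\ #|[pred i | d i == 1]| <= 1) \/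
      (2 <= m /\ forall i, 1 < d i) ->
        ~ property_N
            (2 * min_over
                   [pred ij : 'I_m * 'I_m |
                     [&& ij.1 != ij.2, 1 < d ij.1 & 1 < d ij.2]]
                   (fun ij => d ij.1 + d ij.2) - 2)
            (segre_veronese k n d)].
Proof.
have cardC : #|[pred i | d i == 1]| + #|[pred i | 1 < d i]| = m.
  rewrite -[RHS]card_ord -(cardC [pred i | d i == 1]); congr (_ + _).
  by apply: eq_card => i; rewrite !inE ltn_neqAle d_ge1 andbT eq_sym.
split.
- move=> _ /card_gt2P[i1 [i2 [i3 [[]]]]].
  rewrite !inE => /eqP d1 /eqP d2 /eqP d3 [i12 i23 i31] [_].
  (* Three factors of degree 1 give a hexagon of length 6 = 4 + 2. *)
  apply: (hexagon_not_N2 n_ge1 d_ge1 i12 _ i23 d1 d2); first by rewrite eq_sym.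
  by rewrite d3.
- move=> m_ge3 card2.
  have /card_gt0P[i0 di0] : 0 < #|[pred i | 1 < d i]| by lia.
  (* For a factor attaining the minimum the hexagon has length [2 * d i3 + 4], which is q + 2. *)
  have [[i3 di3 ->] _] := min_overP d di0.
  have /card_gt1P[i1 [i2 []]] : 1 < #|[pred i | d i == 1]| by rewrite card2.
  rewrite !inE => /eqP d1 /eqP d2 i12 [_].
  have other i : d i = 1 -> i != i3.
    by move=> d_i; apply: contraTneq di3 => <- /=; rewrite d_i.
  apply: (hexagon_not_N2 n_ge1 d_ge1 i12 (other _ d1) (other _ d2) d1 d2).
  by rewrite -addnA.
move=> hyp.
have /card_gt1P[i0 [j0 []]] : 1 < #|[pred i | 1 < d i]|.
  case: hyp => [[]|[m_ge2 d_gt1]]; first by lia.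
  by rewrite (eq_card (B := predT)) ?card_ord // => i; rewrite !inE d_gt1.
rewrite !inE => di0 dj0 ij0.
pose P := [pred ij : 'I_m * 'I_m | [&& ij.1 != ij.2, 1 < d ij.1 & 1 < d ij.2]].
have P0 : P (i0, j0) by rewrite /= ij0 di0 dj0.
(* For a pair attaining the minimum the rectangle has perimeter [2 * (d i + d j)], which is q +
   2. *)
have [[[i j] /and3P[/= ij di dj] ->] _] := min_overP (fun ij => d ij.1 + d ij.2) P0.
by move=> [_]; apply: (square_not_N2 n_ge1 d_ge1 ij di dj) => /=; lia.
Qed.
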